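(* Let $\mathbf{Y}$ be the solution space of a two-layer cellular neural network, let $\mathbf{Y}^{(1)}$ be its hidden space and $\mathbf{Y}^{(2)}$ its output space, and let $W^{(1)},W^{(2)}$ be the associated covering subshifts of finite type with finite-to-one factor maps $\phi^{(\ell)}:W^{(\ell)}\to\mathbf{Y}^{(\ell)}$, $\ell=1,2$ (all defined in the context). Suppose that $\mathbf{Y}^{(1)}$ and $\mathbf{Y}^{(2)}$ are finite shift equivalent (FSE) and that $W^{(1)}$ and $W^{(2)}$ are irreducible. Let $i\in\{1,2\}$ and $\overline{i}=3-i$. If $\phi^{(i)}$ has a synchronizing word, then the following hold. (i) There is a one-to-one correspondence between $\mathcal{M}_{\max}(W^{(i)})$ and $\mathcal{M}_{\max}(\mathbf{Y}^{(i)})$. (ii) Let $m_i=|\mathcal{A}(W^{(i)})|$, $n_i=|\mathcal{A}(\mathbf{Y}^{(i)})|$, and let $\mu^{(i)}$ be a maximal measure of $W^{(i)}$. Then $$\dim W^{(i)}=\frac{h_{\mu^{(i)}}(W^{(i)})}{\log m_i}=2\,\frac{h_{\mu^{(i),+}}(W^{(i),+})}{\log m_i}$$ and $$\dim \mathbf{Y}^{(i)}=\frac{h_{\phi^{(i)}\mu^{(i)}}(\mathbf{Y}^{(i)})}{\log n_i}=\frac{h_{\mu^{(i)}}(W^{(i)})}{\log n_i}=2\,\frac{h_{\mu^{(i),+}}(W^{(i),+})}{\log n_i},$$ where $\mu^{(i),+}$ is the maximal measure of the right-sided subspace $W^{(i),+}$ of $W^{(i)}$. (iii) Suppose $\pi:W^{(i)}\to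 W^{(\overline{i})}$ is a factor map, and let $\nu^{(\ell)}=\phi^{(\ell)}\mu^{(\ell)}$, where $\mu^{(\ell)}$ is a maximal measure of $W^{(\ell)}$ and $n_\ell=|\mathcal{A}(\mathbf{Y}^{(\ell)})|$, $\ell=1,2$. If $$\dim\mathbf{Y}^{(i)}=\frac{h_{\nu^{(i)}}(\mathbf{Y}^{(i)})}{\log n_i},$$ then $$\dim\mathbf{Y}^{(\overline{i})}=\frac{h_{\overline{\pi}\nu^{(i)}}(\mathbf{Y}^{(\overline{i})})}{\log n_{\overline{i}}}=\frac{h_{\nu^{(\overline{i})}}(\mathbf{Y}^{(\overline{i})})}{\log n_{\overline{i}}}$$ for some map $\overline{\pi}:\mathcal{M}_{\max}(\mathbf{Y}^{(i)})\to\mathcal{M}_{\max}(\mathbf{Y}^{(\overline{i})})$, where $\overline{\pi}\nu^{(i)}$ is the image of $\nu^{(i)}$ under $\overline{\pi}$.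
   Context: **Two-layer cellular neural networks.** For $\ell=1,2$ fix real templates $(a^{(\ell)}_k)_{k\in K}$, $(b^{(\ell)}_k)_{k\in K}$ and a threshold $z^{(\ell)}\in\mathbb{R}$, where $K=\{-d,\dots,d\}$ for some $d\in\mathbb{N}$ (in the simplified network, $K=\{0,1\}$ and $b^{(1)}=0$). The network is $$\frac{dx_i^{(\ell)}}{dt}=-x_i^{(\ell)}+\sum_{k\in K}a_k^{(\ell)}y_{i+k}^{(\ell)}+\sum_{k\in K}b_k^{(\ell)}u_{i+k}^{(\ell)}+z^{(\ell)},\quad i\in\mathbb{Z},\ \ell=1,2,$$ with $y=f(x)=\frac12(|x+1|-|x-1|)$ and $u_i^{(2)}=y_i^{(1)}$. For $v,w\in\{-1,1\}^K$ say that $(v,w)$ is $\ell$-admissible if either $v_0=1$ and $a_0^{(\ell)}-1+z^{(\ell)}>-(\sum_{k\ne0}a_k^{(\ell)}v_k+\sum_k b_k^{(\ell)}w_k)$, or $v_0=-1$ and $a_0^{(\ell)}-1-z^{(\ell)}>\sum_{k\neq0}a_k^{(\ell)}v_k+\sum_k b_k^{(\ell)}w_k$. The basic set of admissible local patterns $\mathcal{B}$ is the set of two-row patterns $v^{(2)}\diamond v^{(1)}$ ($v^{(2)}$ top row, $v^{(1)}$ bottom row, each in $\{-1,1\}^K$) such that $(v^{(2)},v^{(1)})$ is 2-admissible and $(v^{(1)},w)$ is 1-admissible for some input $w$. The solution space is $$\mathbf{Y}=\{\mathbf{y}^{(2)}\diamond\mathbf{y}^{(1)}:\ (y^{(2)}_{i+k})_{k\in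 K}\diamond(y^{(1)}_{i+k})_{k\in K}\in\mathcal{B}\text{ for all }i\in\mathbb{Z}\},$$ and $\mathbf{Y}^{(1)}$ (hidden space), $\mathbf{Y}^{(2)}$ (output space) $\subseteq\{-1,1\}^{\mathbb{Z}}$ are its projections to the first and second layers. **The covering spaces $W^{(i)}$.** Let $r=|K|$. Let $G$ be the directed graph whose vertices are the two-row $\pm1$ patterns of width $r-1$, with an edge $p\to q$ whenever $p,q$ are the first and last $r-1$ columns of a pattern in $\mathcal{B}$; label this edge by the $i$-th layer row ($i=1,2$) of that pattern. Apply the subset construction to this labeled graph: starting from the singletons $\{p\}$, add for each set $S$ and each label $\alpha$ the nonempty set $S'$ of all terminal vertices of edges labeled $\alpha$ starting in $S$, together with an edge $S\to S'$ labeled $\alpha$; then repeatedly delete vertices having no incoming or no outgoing edge. The resulting labeled graph is right-resolving (edges leaving a vertex have distinct labels). Let $T^{(i)}$ be its $0$-$1$ transition matrix and $W^{(i)}$ the two-sided topological Markov chain determined by $T^{(i)}$, with alphabet $\mathcal{A}(W^{(i)})$ the vertex set. All patterns in a vertex share the same $i$-th layer row, and $\phi^{(i)}:W^{(i)}\to\mathbf{Y}^{(i)}$ is the one-block map sending a vertex to the last symbol of this common row; it is a finite-to-one factor map. **Shift spaces.** $\mathcal{A}(X)$ is the alphabet of $X$ and $\sigma$ is the shift. A factor map is a continuous onto map commuting with the shifts. $X$ and $Y$ are FSE if there are a subshift of finite type $Z$ and finite-to-one factor maps $Z\to X$, $Z\to Y$. A one-block factor map $\phi:X\to Y$ induced by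 $\Phi:\mathcal{A}(X)\to\mathcal{A}(Y)$ has a synchronizing word if there is a word $y_1\cdots y_n$ of $Y$ such that all words $x_1\cdots x_n$ of $X$ with $\Phi(x_k)=y_k$ for all $k$ have the same last symbol $x_n$. **Measures and dimension.** For a $\sigma$-invariant Borel probability measure $\mu$ on $X$, $h_\mu(X)=-\lim_{n\to\infty}\frac1n\sum_{I\in X_n}\mu(I)\log\mu(I)$, where $X_n$ is the collection of cylinders of length $n$. $h(X)$ is topological entropy; $\mu$ is a maximal measure (measure of maximal entropy) if $h_\mu(X)=h(X)$, and $\mathcal{M}_{\max}(X)$ is the set of maximal measures. $\phi\mu=\mu\circ\phi^{-1}$ is the push-forward. The right-sided subspace $W^{(i),+}$ is the one-sided topological Markov chain $\{x\in\mathcal{A}(W^{(i)})^{\mathbb{Z}_{\ge0}}:T^{(i)}(x_k,x_{k+1})=1\ \forall k\ge0\}$. $\dim$ denotes Hausdorff dimension with respect to the metric $d(x,y)=\sum_{k\in\mathbb{Z}}|x_k-y_k|/n^{|k|+1}$, where $n$ is the size of the alphabet and the symbols are identified with $0,1,\dots,n-1$.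
   Formalization: For two-sided shifts, cylinders of length n are taken to fix all coordinates |k|<n, so two-sided measure and topological entropies are twice the usual ones; with the usual entropies h(W)=h(W+), and the identities with the factor 2 in (ii) fail whenever the entropy is positive. *)

(* Defs.v *)
From HB Require Import structures.
From mathcomp Require Import all_boot all_order all_algebra.
From mathcomp Require Import finmap.
From mathcomp Require Import all_classical all_reals all_analysis.

Set Implicit Arguments.
Unset Strict Implicit.
Unset Printing Implicit Defensive.

Import Order.TTheory GRing.Theory Num.Theory.
Import numFieldNormedType.Exports.
Local Open Scope classical_set_scope.
Local Open Scope ring_scope.

(** * Shift spaces *)

(* An index set for sequences, with |k| and k + 1: Z for two-sided and
   Z_{>=0} for one-sided sequences. *)
Record time := Time {
  time_sort :> eqType;
  time_abs : time_sort -> nat;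
  time_next : time_sort -> time_sort }.

Definition Ztime := Time absz (fun k : int => k + 1).
Definition Ntime := Time (@id nat) S.

(* Alphabets of shifts carrying measures are pointed because measurable types
   are. *)
#[short(type="pfinType")]
HB.structure Definition PointedFinite := {T of Finite T & Pointed T}.
HB.instance Definition _ := Pointed.on bool.
HB.instance Definition _ (T : finType) := isPointed.Build {set T} finset.set0.

Definition conf (I : time) (A : choiceType) : Type :=
  {ptws (time_sort I) -> discrete_topology A}.
HB.instance Definition _ I A := Topological.on (conf I A).
HB.instance Definition _ I (A : pfinType) :=
  isPointed.Build (conf I A) (fun=> point).

Definition shift_map (I : time) (A : choiceType) (x : conf I A) : conf I A :=
  fun k => x (time_next k).

Definition window (A : choiceType) (x : conf Ztime A) (k : int) (n : nat) :
  seq A := [seq x (k + j%:Z) | j <- iota 0 n].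

Definition word (A : choiceType) (X : set (conf Ztime A)) (u : seq A) : Prop :=
  exists x k, X x /\ window x k (size u) = u.

Definition alphabet (A : finType) (X : set (conf Ztime A)) : {set A} :=
  [set a : A | `[< exists x k, X x /\ x k = a >]]%SET.

Definition is_SFT (A : finType) (X : set (conf Ztime A)) : Prop :=
  exists F : seq (seq A),
    X = [set x | forall u k, u \in F -> window x k (size u) <> u].

Definition irreducible (A : finType) (X : set (conf Ztime A)) : Prop :=
  forall u v, word X u -> word X v -> exists w, word X (u ++ w ++ v).

Definition factor_map (A B : finType) (X : set (conf Ztime A))
    (Y : set (conf Ztime B)) (f : conf Ztime A -> conf Ztime B) : Prop :=
  [/\ {within X, continuous f},
      f @` X = Y
    & forall x, X x -> f (shift_map x) = shift_map (f x)].

Definition finite_to_one (A B : finType) (X : set (conf Ztime A))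
    (f : conf Ztime A -> conf Ztime B) : Prop :=
  forall y, finite_set (X `&` f @^-1` [set y]).

Definition FSE (A B : finType) (X : set (conf Ztime A))
    (Y : set (conf Ztime B)) : Prop :=
  exists (C : finType) (Z : set (conf Ztime C)),
    [/\ is_SFT Z,
        exists f, factor_map Z X f /\ finite_to_one Z f
      & exists g, factor_map Z Y g /\ finite_to_one Z g].

Definition block_map (I : time) (A B : choiceType) (Phi : A -> B)
  (x : conf I A) : conf I B := fun k => Phi (x k).

Definition has_sync_word (A B : finType) (X : set (conf Ztime A))
    (Y : set (conf Ztime B)) (Phi : A -> B) : Prop :=
  exists y b, word Y (rcons y b) /\
    forall x a x' a', word X (rcons x a) -> word X (rcons x' a') ->
      map Phi (rcons x a) = rcons y b -> map Phi (rcons x' a') = rcons y b ->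
      a = a'.

Definition markov_chain (I : time) (A : finType) (V : {set A}) (T : rel A) :
    set (conf I A) :=
  [set x | forall k, x k \in V /\ T (x k) (x (time_next k))].

(** * Measures and entropy *)

Lemma conf_cvg (I : time) (A : choiceType) (F : set_system (conf I A))
    (x : conf I A) :
  Filter F -> (forall k, F [set y | y k = x k]) -> F --> x.
Proof.
move=> FF Fx; apply/cvg_sup => k U [V] [[W] oW <-] WfN WU.
by apply: (filterS WU); apply: filterS (Fx k) => y /= yx; rewrite /= yx.
Qed.

Lemma coord_nbhs (I : time) (A : choiceType) (x : conf I A) k :
  nbhs x [set y | y k = x k].
Proof.
apply: (@proj_continuous I (fun=> discrete_topology A) k x [set x k]).
by rewrite nbhs_principalE; apply/principal_filterP.
Qed.

Lemma block_map_continuous (I : time) (A B : choiceType) (Phi : A -> B) :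
  continuous (@block_map I A B Phi).
Proof.
move=> x U /=.
have F0 : Filter (nbhs (x : conf I A)) := @nbhs_filter (conf I A) x.
have FF : Filter (fmap (@block_map I A B Phi) (nbhs (x : conf I A))) :=
  @fmap_filter _ _ _ _ F0.
apply: (@conf_cvg I B _ _ FF) => k.
by apply: filterS (coord_nbhs x k) => y /= yx; rewrite /block_map yx.
Qed.

Definition borel (I : time) (A : pfinType) : Type :=
  g_sigma_algebraType (@open (conf I A)).
HB.instance Definition _ I A := Measurable.on (borel I A).

Lemma block_map_measurable (I : time) (A B : pfinType) (Phi : A -> B) :
  measurable_fun [set: borel I A] (block_map Phi : borel I A -> borel I B).
Proof.
move=> _ Y mY; rewrite setTI.
have : <<s @open (conf I A) >> (block_map Phi @^-1` Y); last by [].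
pose G : set (set (conf I B)) :=
  [set Y | <<s @open (conf I A) >> (block_map Phi @^-1` Y)].
suff : <<s @open (conf I B) >> `<=` G by apply.
apply: smallest_sub; last first.
  move=> U oU; apply: sub_sigma_algebra.
  by apply: open_comp oU => x _; exact: block_map_continuous.
split; rewrite /G /=.
- by rewrite preimage_set0; exact: sigma_algebra0.
- by move=> U GU; rewrite setTD preimage_setC -setTD; exact: sigma_algebraCD.
- by move=> F GF; rewrite preimage_bigcup; exact: sigma_algebra_bigcup.
Qed.

Definition block_rv (I : time) (A B : pfinType) (Phi : A -> B) :
  borel I A -> borel I B := block_map Phi.
HB.instance Definition _ (I : time) (A B : pfinType) (Phi : A -> B) :=
  isMeasurableFun.Build _ _ (borel I A) (borel I B) (block_rv Phi)
    (@block_map_measurable I A B Phi).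

Definition push (R : realType) (I : time) (A B : pfinType) (Phi : A -> B)
    (mu : probability (borel I A) R) : probability (borel I B) R :=
  distribution mu (block_rv Phi).

(* The cylinders of length n of X fix the coordinates |k| < n: over Z_{>=0}
   they fix x_0, ..., x_{n-1}; over Z the cylinder extends to length n on both
   sides of the origin, as balls of the metric [symb_dist] below do.  The
   two-sided entropies [entropy] and [top_entropy] are thus twice those given
   by words x_0 ... x_{n-1}; this normalization is forced by the identity
   dim W = h(W) / log m = 2 h(W^+) / log m, in which both h's are defined by
   the same formula. *)
Definition cylinders (I : time) (A : choiceType) (X : set (conf I A))
    (n : nat) : set (set (conf I A)) :=
  [set [set y | X y /\ forall k : I, (time_abs k < n)%N -> y k = x k] | x in X].

Definition entropy (R : realType) (I : time) (A : pfinType)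
    (X : set (conf I A)) (mu : probability (borel I A) R) : R :=
  - lim ((fun n : nat => n%:R^-1 * \sum_(C \in cylinders X n)
            (fine (mu C) * ln (fine (mu C)))) @ \oo).

Definition top_entropy (R : realType) (I : time) (A : finType)
    (X : set (conf I A)) : R :=
  lim ((fun n : nat => n%:R^-1 * ln (#|` fset_set (cylinders X n)|%:R : R))
         @ \oo).

(* Invariant measures on X are probabilities on the full shift carried by X. *)
Definition invariant_measure (R : realType) (I : time) (A : pfinType)
    (X : set (conf I A)) (mu : probability (borel I A) R) : Prop :=
  mu X = 1%E /\
  forall E : set (borel I A), measurable E ->
    mu (@shift_map I A @^-1` E) = mu E.

Definition Mmax (R : realType) (I : time) (A : pfinType) (X : set (conf I A)) :
    set (probability (borel I A) R) :=
  [set mu | invariant_measure X mu /\ entropy X mu = top_entropy R X].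

(* The values of a [probability] on non-measurable sets are irrelevant junk, so
   measures are identified when they agree on measurable sets. *)
Definition eq_measure (R : realType) (I : time) (A : pfinType)
    (mu nu : probability (borel I A) R) : Prop :=
  forall E : set (borel I A), measurable E -> mu E = nu E.

Definition measure_map (R : realType) (I : time) (A B : pfinType)
    (M : set (probability (borel I A) R)) (N : set (probability (borel I B) R))
    (f : probability (borel I A) R -> probability (borel I B) R) : Prop :=
  (forall mu, M mu -> N (f mu)) /\
  (forall mu mu', M mu -> M mu' ->
    eq_measure mu mu' -> eq_measure (f mu) (f mu')).

Definition one_to_one_correspondence (R : realType) (I : time)
    (A B : pfinType) (M : set (probability (borel I A) R))
    (N : set (probability (borel I B) R)) : Prop :=
  exists f, [/\ measure_map M N f,
    forall mu mu', M mu -> M mu' ->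
      eq_measure (f mu) (f mu') -> eq_measure mu mu'
  & forall nu, N nu -> exists2 mu, M mu & eq_measure (f mu) nu].

(** * Hausdorff dimension *)

Section Hausdorff.
Context {R : realType} {T : Type} (d : T -> T -> \bar R).
Local Open Scope ereal_scope.

(* 0 is added so that the empty set has diameter 0. *)
Definition diam (U : set T) : \bar R :=
  ereal_sup (0 |` [set d x y | x in U & y in U]).

Definition hausdorff_pre (s delta : R) (X : set T) : \bar R :=
  ereal_inf [set \sum_(0 <= j <oo) (diam (U j) `^ s) | U in
    [set U : nat -> set T | X `<=` \bigcup_j U j /\
       forall j, U j `<=` X /\ diam (U j) <= delta%:E]].

Definition hausdorff_measure (s : R) (X : set T) : \bar R :=
  ereal_sup [set hausdorff_pre s delta X | delta in [set delta | (0 < delta)%R]].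

Definition hausdorff_dim (X : set T) : \bar R :=
  ereal_inf [set s%:E | s in [set s | (0 < s)%R /\ hausdorff_measure s X = 0]].
End Hausdorff.

(* The symbols in the alphabet S are identified with 0, ..., #|S| - 1 through
   their position in [enum S]. *)
Definition symb_dist (R : realType) (A : finType) (S : {set A})
    (x y : conf Ztime A) : \bar R :=
  \esum_(k in [set: int])
    (`|(index (x k) (enum S))%:R - (index (y k) (enum S))%:R|
       / #|S|%:R ^+ (absz k).+1)%:E.

Definition dimH (R : realType) (A : finType) (S : {set A})
    (X : set (conf Ztime A)) : \bar R :=
  hausdorff_dim (@symb_dist R A S) X.

(** * Two-layer cellular neural networks *)

Variant layer := layer1 | layer2.
Definition other (l : layer) : layer :=
  if l is layer1 then layer2 else layer1.

(* K = {-d, ..., d}, or K = {0, 1} for the simplified network.  The case d = 0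
   is excluded in [cnn]: it would make the vertices of G patterns of width 0,
   whose rows have no last symbol. *)
Variant nbhd := Symmetric of nat | Simplified.
Definition left_radius (K : nbhd) : nat :=
  if K is Symmetric d then d else 0%N.
Definition right_radius (K : nbhd) : nat :=
  if K is Symmetric d then d else 1%N.

(* This is r - 1, where r is the size of K; the position j : 'I_r stands for
   the element j - left_radius K of K. *)
Definition rpred (K : nbhd) : nat := (left_radius K + right_radius K)%N.

Record cnn (R : realType) := Cnn {
  cnn_nbhd : nbhd;
  cnn_a : layer -> 'I_(rpred cnn_nbhd).+1 -> R;
  cnn_b : layer -> 'I_(rpred cnn_nbhd).+1 -> R;
  cnn_z : layer -> R;
  cnn_wf : match cnn_nbhd return Prop with
           | Symmetric d => (0 < d)%N
           | Simplified => forall k, cnn_b layer1 k = 0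
           end }.
Arguments cnn_a {R} c.
Arguments cnn_b {R} c.
Arguments cnn_z {R} c.

(* The symbols 1 and -1 are encoded by the booleans true and false. *)
Definition spin (R : realType) (s : bool) : R := if s then 1 else -1.

(* A two-row pattern is the pair of its top row (layer 2) and its bottom row
   (layer 1). *)
Notation pattern n := (n.-tuple bool * n.-tuple bool)%type.

Definition layer_row (n : nat) (l : layer) (p : pattern n) : n.-tuple bool :=
  if l is layer2 then p.1 else p.2.

Definition init_tuple (T : Type) n (v : n.+1.-tuple T) : n.-tuple T :=
  [tuple tnth v (widen_ord (leqnSn n) j) | j < n].
Definition tail_tuple (T : Type) n (v : n.+1.-tuple T) : n.-tuple T :=
  [tuple tnth v (lift ord0 j) | j < n].
Definition first_cols n (p : pattern n.+1) : pattern n :=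
  (init_tuple p.1, init_tuple p.2).
Definition last_cols n (p : pattern n.+1) : pattern n :=
  (tail_tuple p.1, tail_tuple p.2).

Section CNN.
Context {R : realType} (N : cnn R).
Local Notation K := (cnn_nbhd N).
Local Notation r := (rpred K).+1.

Definition center : 'I_r := inord (left_radius K).

Definition admissible (l : layer) (v w : r.-tuple bool) : bool :=
  let a := cnn_a N l in let b := cnn_b N l in let z := cnn_z N l in
  let S := \sum_(k | k != center) a k * spin R (tnth v k)
           + \sum_k b k * spin R (tnth w k) in
  if tnth v center then a center - 1 + z > - S else a center - 1 - z > S.

Definition basic_set : {set pattern r} :=
  [set p | admissible layer2 (layer_row layer2 p) (layer_row layer1 p)
           && [exists w, admissible layer1 (layer_row layer1 p) w]]%SET.

Definition local_row (y : conf Ztime bool) (i : int) : r.-tuple bool :=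
  [tuple y (i + (j : nat)%:Z - (left_radius K)%:Z) | j < r].

(* Pairs (y^(2), y^(1)). *)
Definition solution_space : set (conf Ztime bool * conf Ztime bool) :=
  [set y | forall i, (local_row y.1 i, local_row y.2 i) \in basic_set].

Definition layer_space (l : layer) : set (conf Ztime bool) :=
  if l is layer2 then fst @` solution_space else snd @` solution_space.

(** ** The covering spaces *)

Definition vertex : finType := pattern (rpred K).

Definition step (l : layer) (S : {set vertex}) (alpha : r.-tuple bool) :
    {set vertex} :=
  [set last_cols p | p in basic_set
     & (first_cols p \in S) && (layer_row l p == alpha)]%SET.

Definition arrow (l : layer) : rel {set vertex} := fun S S' =>
  (S' != finset.set0) && [exists alpha, S' == step l S alpha].

Definition reachable (l : layer) : {set {set vertex}} :=
  [set S | [exists p, connect (arrow l) [set p]%SET S]]%SET.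

Definition prune (l : layer) (D : {set {set vertex}}) : {set {set vertex}} :=
  [set S in D | [exists S', (S' \in D) && arrow l S' S]
                && [exists S', (S' \in D) && arrow l S S']]%SET.

(* #|reachable l| rounds of deletion suffice for the process to be stable. *)
Definition cover_alphabet (l : layer) : {set {set vertex}} :=
  iter #|reachable l| (prune l) (reachable l).

Definition cover (I : time) (l : layer) : set (conf I {set vertex}) :=
  @markov_chain I _ (cover_alphabet l) (arrow l).

Definition W (l : layer) := @cover Ztime l.
Definition Wplus (l : layer) := @cover Ntime l.

(* Last symbol of the l-th row of an element of S; these rows all agree.  The
   covering map W^(l) -> Y^(l) is [block_map (cover_symbol l)]. *)
Definition cover_symbol (l : layer) (S : {set vertex}) : bool :=
  if [pick p in S] is Some p then last true (layer_row l p) else true.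

End CNN.

Arguments cover_alphabet {R} N l.
Arguments cover {R} N I l.
Arguments W {R} N l.
Arguments Wplus {R} N l.
Arguments cover_symbol {R} N l S.
Arguments Mmax R {I A} X.

(* Main.v *)
(* A shift with bounded gaps (any two words are joined by a connecting word of
   bounded length) has about exp(nL) words of length n, up to constant factors.
   Counting refinements of cylinders then gives topological entropy 2L (windows
   extend on both sides of the origin) and Hausdorff dimension 2L / ln m, and
   words avoiding a given word are exponentially rarer.  A maximal measure must
   therefore see every word, and by invariance arbitrarily far in the past.  The
   covering map W -> Y is right-resolving, hence a bounded-to-one factor map that
   changes block entropies by at most a constant; a synchronizing word occurring
   in the past of almost every point makes it invertible almost everywhere, for
   all maximal measures on Y and on W. *)

Require Import Defs.
From HB Require Import structures.
From mathcomp Require Import all_boot all_order all_algebra finmap.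
From mathcomp Require Import all_classical all_reals all_analysis.
From mathcomp Require Import zify ring lra.

Set Implicit Arguments.
Unset Strict Implicit.
Unset Printing Implicit Defensive.

Import Order.TTheory GRing.Theory Num.Theory.
Import numFieldNormedType.Exports.
Local Open Scope classical_set_scope.
Local Open Scope ring_scope.

(** * Words *)

(** An irreducible chain may be periodic, so connecting words have bounded but not prescribed
    length; each count therefore loses a constant factor, and a bounded additive error around nL is
    what survives. That precision is enough for the lower dimension bound, where the proportion of
    long windows contained in a cylinder plays the part of its mass. Compactness reduces a countable
    cover to a finite one, so that a single window length serves all its members. The
    right-resolving property carries knowledge of a covering symbol forward in time only. Hence the
    synchronizing word has to be seen before every coordinate, and occurrence somewhere must be
    strengthened to occurrence arbitrarily far in the past. The correspondence in (i) is the
    push-forward; its inverse pushes along a section of the covering map, whose measurability comes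
    from the fact that each covering symbol is decided by a finite window. That the layer space is
    the image of the cover also rests on compactness: the subset construction is followed from ever
    earlier starting times, or traced back from ever later ones. *)

Definition translate (A : choiceType) (x : conf Ztime A) (j : int) :
  conf Ztime A := fun k => x (k + j).

Section Window.
Context {A : choiceType}.
Implicit Types (x y : conf Ztime A) (X : set (conf Ztime A)).

Lemma size_window x k n : size (window x k n) = n.
Proof. by rewrite size_map size_iota. Qed.

Lemma nth_window a x k n j : (j < n)%N -> nth a (window x k n) j = x (k + j%:Z).
Proof.
by move=> jn; rewrite (nth_map 0%N) ?size_iota // nth_iota // add0n.
Qed.

Lemma window_add x k m n :
  window x k (m + n) = window x k m ++ window x (k + m%:Z) n.
Proof.
rewrite /window iotaD map_cat; congr (_ ++ _); rewrite add0n.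
rewrite -[in LHS](addn0 m) iotaDl -map_comp; apply: eq_map => j /=.
by rewrite -addrA -PoszD.
Qed.

Lemma window1 x k : window x k 1 = [:: x k].
Proof. by rewrite /window /= addr0. Qed.

Lemma windowS x k n : window x k n.+1 = rcons (window x k n) (x (k + n%:Z)).
Proof. by rewrite -addn1 window_add window1 cats1. Qed.

Lemma window_translate x j k n :
  window (translate x j) k n = window x (k + j) n.
Proof. by apply: eq_map => i; rewrite /translate addrAC. Qed.

Lemma window_eqP x y k l n :
  window x k n = window y l n <->
  forall j, (j < n)%N -> x (k + j%:Z) = y (l + j%:Z).
Proof.
split=> [e j jn|e].
  by rewrite -(nth_window (x k) x k jn) e nth_window.
by apply/eq_in_map => j; rewrite mem_iota add0n => /andP[_]; exact: e.
Qed.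

Lemma map_window (B : choiceType) (f : A -> B) x k n :
  map f (window x k n) = window (block_map f x : conf Ztime B) k n.
Proof. by rewrite -map_comp. Qed.

Lemma word_window X x k n : X x -> word X (window x k n).
Proof. by move=> Xx; exists x, k; rewrite size_window. Qed.

Lemma word_infix X u v w : word X (u ++ v ++ w) -> word X v.
Proof.
move=> [x [k [Xx]]]; rewrite !size_cat !window_add => /eqP.
rewrite eqseq_cat ?size_window // => /andP[_].
rewrite eqseq_cat ?size_window // => /andP[/eqP <- _].
exact: word_window.
Qed.

Lemma word_prefix X u v : word X (u ++ v) -> word X u.
Proof. exact: (@word_infix X [::]). Qed.

Lemma word_suffix X u v : word X (u ++ v) -> word X v.
Proof. by move=> wuv; apply: (@word_infix X u _ [::]); rewrite cats0. Qed.

Lemma word_extend X u n : word X u -> exists v : n.-tuple A, word X (u ++ v).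
Proof.
move=> [x [k [Xx <-]]].
have sz : size (window x (k + (size u)%:Z) n) == n by rewrite size_window.
exists (Tuple sz) => /=.
by rewrite -window_add; exact: word_window.
Qed.

End Window.

Lemma card_bigcup_le (T I : finType) (P : pred I) (F : I -> {set T}) :
  (#|\bigcup_(i | P i) F i|%SET <= \sum_(i | P i) #|F i|)%N.
Proof.
elim/big_rec2 : _ => [|i k S _ IH]; first by rewrite cards0.
by rewrite (leq_trans (leq_card_setU _ _))// leq_add2l.
Qed.

(** * Follower counts and their near-multiplicativity *)

Section Counting.
Context {A : finType}.
Variable X : set (conf Ztime A).

Definition num_ext (u : seq A) (n : nat) : nat :=
  #|[set v : n.-tuple A | `[< word X (u ++ v) >]]%SET|.

Definition Nwords (n : nat) : nat := num_ext [::] n.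

Lemma ext_sum u n :
  num_ext u n = (\sum_(v : n.-tuple A | `[< word X (u ++ v) >]) 1)%N.
Proof. by rewrite sum1_card; apply: eq_card => v; rewrite inE. Qed.

Lemma ext_le u n : (num_ext u n <= Nwords n)%N.
Proof.
apply: subset_leq_card; apply/fintype.subsetP => v; rewrite !inE => /asboolP.
by move=> /asboolP wuv; exact: word_suffix wuv.
Qed.

Lemma ext_gt0 u n : word X u -> (0 < num_ext u n)%N.
Proof.
move=> /(word_extend n)[v wv]; apply/card_gt0P; exists v.
by rewrite inE; exact/asboolP.
Qed.

Lemma sum_tuple_cat m n (P : pred (seq A)) :
  (\sum_(z : (m + n).-tuple A | P z) 1
   = \sum_(v : m.-tuple A) \sum_(w : n.-tuple A | P (v ++ w)) 1)%N.
Proof.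
pose h (p : m.-tuple A * n.-tuple A) : (m + n).-tuple A :=
  [tuple of p.1 ++ p.2].
have hbij : bijective h.
  apply: inj_card_bij; last by rewrite card_prod !card_tuple expnD.
  move=> [v w] [v' w'] /(congr1 val) /= /eqP.
  rewrite eqseq_cat ?size_tuple // => /andP[/eqP/val_inj -> /eqP/val_inj ->].
  by [].
rewrite (reindex h) /=; last exact: onW_bij.
by rewrite pair_big_dep.
Qed.

Lemma ext_add u m n :
  num_ext u (m + n)
  = (\sum_(v : m.-tuple A | `[< word X (u ++ v) >]) num_ext (u ++ v) n)%N.
Proof.
rewrite ext_sum (sum_tuple_cat _ _ (fun z => `[< word X (u ++ z) >])).
rewrite [RHS]big_mkcond; apply: eq_bigr => v _; rewrite ext_sum.
case: ifPn => [_|/asboolPn nw]; first by under eq_bigl do rewrite catA.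
by rewrite big_pred0 // => w; apply/asboolPn; rewrite catA => /word_prefix.
Qed.

Lemma ext_mono u m n : (num_ext u m <= num_ext u (m + n))%N.
Proof.
rewrite ext_add ext_sum; apply: leq_sum => v /asboolP wv.
exact: ext_gt0.
Qed.

Lemma ext_add_le u m n : (num_ext u (m + n) <= num_ext u m * Nwords n)%N.
Proof.
rewrite ext_add ext_sum big_distrl /=; apply: leq_sum => v _.
by rewrite mul1n ext_le.
Qed.

Lemma Nwords_add_le m n : (Nwords (m + n) <= Nwords m * Nwords n)%N.
Proof. exact: ext_add_le. Qed.

Lemma Nwords_gt0 n : X !=set0 -> (0 < Nwords n)%N.
Proof. by move=> [x Xx]; apply: ext_gt0; exists x, 0. Qed.

(** Only a bound on the gap is asked, not a fixed length, so that periodic irreducible chains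
    qualify. *)
Definition gap_bounded (g : nat) := forall u v, word X u -> word X v ->
  exists2 w, (size w <= g)%N & word X (u ++ w ++ v).

Variable g : nat.
Hypothesis Xg : gap_bounded g.

(** The factor [g.+1] counts the possible gap lengths; [Nwords g] pays for the at most g surplus
    letters that a gap adds. *)
Definition gap_const := (g.+1 * Nwords g)%N.

(** Every word of length n follows u after some gap x, so these words are covered by the followers
    of the words [u ++ x]. All prefixes thus have comparably many followers. *)
Lemma ext_ge u n : word X u -> (Nwords n <= gap_const * num_ext u n)%N.
Proof.
move=> wu.
pose D (j : nat) (x : j.-tuple A) : {set n.-tuple A} :=
  [set v : n.-tuple A | `[< word X ((u ++ x) ++ v) >]]%SET.
have sub : ([set v : n.-tuple A | `[< word X ([::] ++ v) >]] \subset
    \bigcup_(j < g.+1) \bigcup_(x : j.-tuple A | `[< word X (u ++ x) >])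
      D j x)%SET.
  apply/fintype.subsetP => v; rewrite inE => /asboolP wv.
  have [x xg wx] := Xg wu wv; rewrite catA in wx.
  have xj : size x == (inord (size x) : 'I_g.+1) :> nat by rewrite inordK.
  apply/finset.bigcupP; exists (inord (size x)) => //.
  apply/finset.bigcupP; exists (Tuple xj) => //=.
    by apply/asboolP; exact: word_prefix wx.
  by rewrite inE; apply/asboolP.
apply: (leq_trans (subset_leq_card sub)).
apply: (leq_trans (card_bigcup_le _ _)).
apply: (@leq_trans (\sum_(j < g.+1) num_ext u (n + g))%N); last first.
  rewrite sum_nat_const card_ord -mulnA leq_mul2l /=.
  by rewrite mulnC ext_add_le.
apply: leq_sum => j _.
(* Padding to the common length n + g makes the bound independent of the gap length j. *)
have -> : (n + g = j + n + (g - j))%N by have := ltn_ord j; lia.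
apply: leq_trans (ext_mono _ _ _); rewrite ext_add.
exact: card_bigcup_le.
Qed.

Lemma Nwords_mul_le m n :
  (Nwords m * Nwords n <= gap_const * Nwords (m + n))%N.
Proof.
rewrite [Nwords (m + n)]ext_add [Nwords m]ext_sum big_distrr big_distrl /=.
by apply: leq_sum => v /asboolP wv; rewrite mul1n; exact: ext_ge.
Qed.

End Counting.
(** * Growth rate *)

(** Reading a(mn) both as m blocks of length n and as n blocks of length m gives (a m - K)/m <= (a n
    + K)/n for all positive m, n. Any number between the two families is a suitable L; the supremum
    of the left one is taken. *)
Lemma almost_additive (R : realType) (a : nat -> R) (K : R) :
  (forall m n, `|a (m + n)%N - a m - a n| <= K) ->
  exists L, forall n, `|a n - n%:R * L| <= K.
Proof.
move=> aK.
have K0 : 0 <= K := le_trans (normr_ge0 _) (aK 0%N 0%N).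
have amul k n : `|a (k.+1 * n)%N - k.+1%:R * a n| <= k%:R * K.
  elim: k => [|k IH]; first by rewrite mul1n mul1r subrr normr0 mul0r.
  have := aK n (k.+1 * n)%N; rewrite -mulSn => h.
  rewrite -[in k.+2%:R]addn1 -[in leRHS]addn1 !natrD !mulrDl !mul1r.
  move: IH h; rewrite !ler_norml => /andP[? ?] /andP[? ?].
  by apply/andP; split; lra.
have cross m n : (0 < m)%N -> (0 < n)%N ->
    (a m - K) / m%:R <= (a n + K) / n%:R.
  move=> m0 n0; rewrite ler_pdivrMr ?ltr0n // mulrAC ler_pdivlMr ?ltr0n //.
  have := amul n.-1 m; have := amul m.-1 n; rewrite !prednK // (mulnC n).
  rewrite !ler_norml => /andP[_ h1] /andP[h2 _]; rewrite mulrBl mulrDl.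
  have : m.-1%:R * K <= m%:R * K by rewrite ler_wpM2r // ler_nat leq_pred.
  have : n.-1%:R * K <= n%:R * K by rewrite ler_wpM2r // ler_nat leq_pred.
  lra.
pose E := [set (a n.+1 - K) / n.+1%:R | n in [set: nat]].
have E0 : E !=set0 by exists ((a 1%N - K) / 1%:R); exists 0%N.
exists (sup E) => -[|n].
  by rewrite mul0r subr0; have := aK 0%N 0%N; rewrite subrr sub0r normrN.
have Eub : ubound E ((a n.+1 + K) / n.+1%:R).
  by move=> _ [k _ <-]; exact: cross.
have lo : (a n.+1 - K) / n.+1%:R <= sup E.
  by apply: ub_le_sup; [exists ((a n.+1 + K) / n.+1%:R)|exists n].
have hi : sup E <= (a n.+1 + K) / n.+1%:R by exact: ge_sup.
move: lo hi; rewrite ler_pdivrMr ?ltr0n // ler_pdivlMr ?ltr0n // => lo hi.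
by rewrite ler_norml; apply/andP; split; lra.
Qed.

Lemma cvg_linear_growth (R : realType) (a : nat -> R) (L K : R) :
  (forall n, `|a n - n%:R * L| <= K) ->
  (fun n : nat => n%:R^-1 * a n) @ \oo --> L.
Proof.
move=> aK; apply/cvgrPdist_le => e e0.
have K0 : 0 <= K := le_trans (normr_ge0 _) (aK 0%N).
have [N HN] : exists N : nat, K / e <= N%:R.
  by exists (Num.truncn (K / e)).+1; rewrite ltW // truncnS_gt.
near=> n.
have n0 : 0 < n%:R :> R by rewrite ltr0n; near: n; exists 1%N.
have -> : L - n%:R^-1 * a n = - (n%:R^-1 * (a n - n%:R * L)).
  by rewrite mulrBr mulKf ?gt_eqF // opprB.
rewrite normrN normrM gtr0_norm ?invr_gt0 // mulrC ler_pdivrMr //.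
apply: le_trans (aK n) _.
rewrite mulrC -ler_pdivrMr //.
apply: le_trans HN _; rewrite ler_nat; near: n; exists N.
Unshelve. all: by end_near. Qed.

(** The error is bounded rather than o(n), which allows cylinder proportions to be estimated up to a
    constant factor. *)
Definition has_growth (R : realType) (A : finType) (X : set (conf Ztime A))
  (L : R) := exists K, forall n, `|ln (Nwords X n)%:R - n%:R * L| <= K.

Lemma ln_nat_ge0 (R : realType) n : 0 <= ln (n%:R : R).
Proof.
case: n => [|n]; first by rewrite ln0.
by apply: ln_ge0; rewrite ler1n.
Qed.

Lemma gap_bounded_growth (R : realType) (A : finType)
    (X : set (conf Ztime A)) g :
  X !=set0 -> gap_bounded X g -> exists L : R, has_growth X L.
Proof.
move=> X0 Xg; have N0 n := Nwords_gt0 n X0.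
have [|L HL] := @almost_additive R (fun n => ln (Nwords X n)%:R)
   (ln (gap_const X g)%:R); last by exists L, (ln (gap_const X g)%:R).
move=> m n; rewrite ler_norml.
have C0 : (0 < gap_const X g)%N by rewrite muln_gt0 N0.
have lnM' p q : (0 < p)%N -> (0 < q)%N ->
    ln ((p * q)%N%:R : R) = ln p%:R + ln q%:R.
  by move=> p0 q0; rewrite natrM lnM // posrE ltr0n.
have h1 : ln (Nwords X (m + n))%:R <= ln (Nwords X m)%:R + ln (Nwords X n)%:R :> R.
  rewrite -lnM' // ler_ln ?posrE ?ltr0n ?muln_gt0 ?N0 // ler_nat.
  exact: Nwords_add_le.
have h2 : ln (Nwords X m)%:R + ln (Nwords X n)%:R <=
     ln (gap_const X g)%:R + ln (Nwords X (m + n))%:R :> R.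
  rewrite -!lnM' // ler_ln ?posrE ?ltr0n ?muln_gt0 ?N0 ?C0 // ler_nat.
  exact: Nwords_mul_le.
have h3 := ln_nat_ge0 R (gap_const X g).
by apply/andP; split; lra.
Qed.

Lemma growth_ge0 (R : realType) (A : finType) (X : set (conf Ztime A)) (L : R) :
  has_growth X L -> 0 <= L.
Proof.
move=> [K XK].
have h := cvg_linear_growth XK; rewrite -(cvg_lim _ h) //.
apply: limr_ge; first by apply/cvg_ex; exists L.
by apply: nearW => n; rewrite mulr_ge0 ?invr_ge0 ?ln_nat_ge0.
Qed.
(** * Finite windows and compactness *)

Definition agree (I : time) (A : choiceType) (n : nat) (x y : conf I A) :=
  forall k : I, (time_abs k < n)%N -> x k = y k.

(** Topological closedness, expressed by central windows so that it combines directly with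
    [exists_cluster]. *)
Definition limit_closed (I : time) (A : choiceType) (X : set (conf I A)) :=
  forall x, (forall n, exists2 y, X y & agree n y x) -> X x.

Lemma agreeS (A : choiceType) n (x y : conf Ztime A) :
  agree n x y -> x n%:Z = y n%:Z -> x (- n%:Z) = y (- n%:Z) ->
  agree n.+1 x y.
Proof.
move=> xy xyn xyNn k /=; rewrite ltnS leq_eqVlt => /orP[|/xy//].
by move=> kn; have [->|->] : k = n%:Z \/ k = - n%:Z by lia.
Qed.

Lemma agree_le (I : time) (A : choiceType) m n (x y : conf I A) :
  (m <= n)%N -> agree n x y -> agree m x y.
Proof. by move=> mn xy k km; apply: xy; exact: leq_trans mn. Qed.

Lemma agree_trans (I : time) (A : choiceType) n (x y z : conf I A) :
  agree n x y -> agree n y z -> agree n x z.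
Proof. by move=> xy yz k kn; rewrite xy // yz. Qed.

(* Along an ultrafilter finer than [\oo] every coordinate of a sequence over a
   finite alphabet is eventually constant. *)
Lemma exists_cluster (A : finType) (x : nat -> conf Ztime A) :
  exists z, forall n N, exists2 m, (N <= m)%N & agree n (x m) z.
Proof.
have [U [UU ooU]] := @ultraFilterLemma _ (\oo : set_system nat) _.
have /choice[z zP] : forall k : int, exists a, U [set m | x m k = a].
  move=> k; apply: contrapT => /forallNP noa.
  have cU a : U (~` [set m | x m k = a]).
    by have [/noa|] := in_ultra_setVsetC [set m | x m k = a] UU.
  have : U [set m | forall a, a \in enum A -> x m k <> a].
    elim: (enum A) => [|a s IH]; first by apply: filterS filterT.
    apply: filterS2 (cU a) IH => m /= xa IH b; rewrite inE => /orP[/eqP->//|].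
    exact: IH.
  move=> /filter_ex[m]; apply; last reflexivity.
  by rewrite mem_enum.
exists z => n N.
have Uz : U [set m | agree n (x m) z].
  elim: n => [|n IH]; first by apply: filterS filterT => m _ k.
  apply: filterS3 IH (zP n) (zP (- n%:Z)) => m; exact: agreeS.
have UN : U [set m | (N <= m)%N] by apply: ooU; exists N.
by have [m [? ?]] := filter_ex (filterI UN Uz); exists m.
Qed.

Lemma size_cwindow (A : choiceType) n (x : conf Ztime A) :
  size (window x (1 - n%:Z) n.*2.-1) == n.*2.-1.
Proof. by rewrite size_window. Qed.

(** The coordinates from 1 - n to n - 1, those fixed by a two-sided cylinder of length n. For n = 0
    the truncated predecessor makes the window empty, as it should be. *)
Definition cwindow (A : choiceType) n (x : conf Ztime A) : n.*2.-1.-tuple A :=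
  Tuple (size_cwindow n x).

Lemma cwindow_agree (A : choiceType) n (x y : conf Ztime A) :
  cwindow n x = cwindow n y <-> agree n x y.
Proof.
split=> [/(congr1 val)/window_eqP xy k /= kn|xy].
  have := xy (absz ((k : int) + n%:Z - 1)%R).
  have -> : 1 - n%:Z + (absz ((k : int) + n%:Z - 1)%R)%:Z = k by lia.
  by apply; lia.
by apply/val_inj/window_eqP => j jn; apply: xy => /=; lia.
Qed.

Definition initial_word (A : choiceType) n (x : conf Ntime A) : n.-tuple A :=
  [tuple x (j : nat) | j < n].

Lemma initial_word_agree (A : choiceType) n (x y : conf Ntime A) :
  initial_word n x = initial_word n y <-> agree n x y.
Proof.
split=> [/(congr1 (fun t => tnth t _)) xy k /= kn|xy].
  by have := xy (Ordinal kn); rewrite !tnth_mktuple.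
by apply: eq_from_tnth => j; rewrite !tnth_mktuple; apply: xy => /=.
Qed.

Section Cylinders.
Context {I : time} {A : choiceType} {T : finType}.
Variables (X : set (conf I A)) (n : nat) (f : conf I A -> T).
Hypothesis fP : forall x y, f x = f y <-> agree n x y.

(** Finite codes of the cylinders. The code f is a parameter so that [cwindow] and [initial_word]
    share the two-sided and the one-sided argument. *)
Definition patterns : {set T} := [set t | `[< exists2 x, X x & f x = t >]]%SET.

Lemma patternsP t : reflect (exists2 x, X x & f x = t) (t \in patterns).
Proof. by rewrite inE; exact: asboolP. Qed.

Lemma cylindersE :
  cylinders X n = (fun t => X `&` f @^-1` [set t]) @` [set` patterns].
Proof.
have cylE x : [set y | X y /\ forall k : I, (time_abs k < n)%N -> y k = x k] =
    X `&` f @^-1` [set f x].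
  by apply/seteqP; split=> y [Xy h]; split => //; exact/fP.
apply/seteqP; split=> [_ [x Xx <-]|_ [t /patternsP[x Xx <-] <-]].
  by rewrite cylE; exists (f x) => //; apply/patternsP; exists x.
by rewrite -cylE; exists x.
Qed.

Lemma cylinder_inj :
  set_inj [set` patterns] (fun t => X `&` f @^-1` [set t]).
Proof.
move=> s t; rewrite inE => /patternsP[x Xx <-] _ /seteqP[/(_ x)h _].
by case: h.
Qed.

Lemma sum_cylinders (R : realType) (F : set (conf I A) -> R) :
  \sum_(C \in cylinders X n) F C =
  \sum_(t in patterns) F (X `&` f @^-1` [set t]).
Proof.
rewrite cylindersE fsbig_image; last exact: cylinder_inj.
rewrite -(bigfs _ (index_enum_uniq T)) // => t _.
by rewrite mem_index_enum.
Qed.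

Lemma card_cylinders : #|` fset_set (cylinders X n)| = #|patterns|.
Proof.
rewrite cylindersE fset_set_image; last exact: finite_finpred.
rewrite card_in_imfset /=; last first.
  move=> s t; rewrite !in_fset_set ?finite_finpred // => sP tP.
  exact: cylinder_inj.
rewrite -(card_finset (mem patterns)); congr #|` _|.
by apply/fsetP => t; rewrite in_fset_set ?finite_finpred // mem_setE in_fset.
Qed.

End Cylinders.

(** * Counting central windows and their refinements *)

Definition translation_invariant (A : choiceType) (X : set (conf Ztime A)) :=
  forall x j, X x -> X (translate x j).

Lemma word_at (A : choiceType) (X : set (conf Ztime A)) u k :
  translation_invariant X -> word X u ->
  exists2 x, X x & window x k (size u) = u.
Proof.
move=> Xinv [x [j [Xx xu]]]; exists (translate x (j - k)); first exact: Xinv.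
by rewrite window_translate addrC subrK.
Qed.

Lemma card_patterns (A : finType) (X : set (conf Ztime A)) n :
  translation_invariant X -> #|patterns X (@cwindow A n)| = Nwords X n.*2.-1.
Proof.
move=> Xinv; rewrite /Nwords /num_ext; congr #|pred_of_set _|.
apply/setP => t; rewrite inE; apply/patternsP/asboolP => [[x Xx <-]|wt].
  exact: word_window.
have [x Xx xt] := word_at (1 - n%:Z) Xinv wt.
by exists x => //; apply: val_inj; rewrite /= -[RHS]xt size_tuple.
Qed.

(** A central window has 2n - 1 letters, one short of 2n; the missing letter costs |L|. The case n =
    0 is separate because 2n - 1 is truncated there. *)
Lemma half_growth (R : realType) (a : nat -> R) (L K : R) n :
  (forall n, `|a n - n%:R * L| <= K) ->
  `|a n.*2.-1 - n%:R * (2 * L)| <= K + `|L|.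
Proof.
move=> aK; case: n => [|n].
  rewrite mul0r; have := aK 0%N; rewrite mul0r => h.
  by rewrite (le_trans h) // lerDl.
rewrite doubleS /=; apply: le_trans (lerD (aK n.*2.+1) (lexx `|L|)).
have -> : a n.*2.+1 - n.+1%:R * (2 * L) = a n.*2.+1 - n.*2.+1%:R * L - L.
  have e : n.+1%:R * 2 = n.*2.+1%:R + 1 :> R.
    by rewrite -natrM natr1; congr _%:R; lia.
  by rewrite mulrA e mulrDl mul1r opprD addrA.
by rewrite (le_trans (ler_normB _ _)).
Qed.

Lemma top_entropyZ (R : realType) (A : finType) (X : set (conf Ztime A)) (L : R) :
  translation_invariant X -> has_growth X L -> top_entropy R X = 2 * L.
Proof.
move=> Xinv [K XK]; apply: cvg_lim => //.
apply: (@cvg_linear_growth _ _ _ (K + `|L|)) => n.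
rewrite (card_cylinders X (@cwindow_agree A n)) card_patterns //.
exact: (half_growth n XK).
Qed.

(** A refinement is a ++ (window of x) ++ b with a, b words of length p = M - n, so there are at
    most [Nwords X p] squared of them. Near-supermultiplicativity, used twice, bounds the product of
    the three counts by the count at length p + q + p, whence the square of [gap_const]. *)
Lemma card_refinements (A : finType) (X : set (conf Ztime A)) g n M
    (x : conf Ztime A) :
  gap_bounded X g -> (0 < n <= M)%N ->
  (#|[set t in patterns X (@cwindow A M) |
       `[< exists2 y, agree n y x & cwindow M y = t >]]%SET|
     * Nwords X n.*2.-1 <= gap_const X g ^ 2 * Nwords X M.*2.-1)%N.
Proof.
move=> Xg /andP[n0 nM]; set E := [set t in _ | _]%SET.
set p := (M - n)%N; set q := n.*2.-1.
have Mpq : M.*2.-1 = (p + (q + p))%N by rewrite /p /q; lia.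
pose d : p.-tuple A := nseq_tuple p (x 0).
pose h (t : M.*2.-1.-tuple A) : p.-tuple A * p.-tuple A :=
  (insubd d (take p t), insubd d (drop q (drop p t))).
have EP t : t \in E -> exists a b : p.-tuple A,
    [/\ word X a, word X b & val t = a ++ window x (1 - n%:Z) q ++ b].
  rewrite inE => /andP[/patternsP[y' Xy' <-] /asboolP[y yx]].
  move=> /(congr1 val) /= /esym yy'.
  have s1 : size (window y' (1 - M%:Z) p) == p by rewrite size_window.
  have s2 : size (window y' n%:Z p) == p by rewrite size_window.
  exists (Tuple s1), (Tuple s2); split; try exact: word_window.
  move: yy'; rewrite Mpq !window_add => yy' /=.
  have -> : window x (1 - n%:Z) q = window y' (1 - M%:Z + p) q.
    move: yy' => /eqP; rewrite eqseq_cat ?size_window // => /andP[_].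
    rewrite eqseq_cat ?size_window // => /andP[/eqP -> _].
    have -> : 1 - M%:Z + p = 1 - n%:Z by rewrite /p; lia.
    by move/cwindow_agree: yx => /(congr1 val) /= ->.
  by have -> : 1 - M%:Z + p + q = n%:Z by rewrite /p /q; lia.
have hE (a b : p.-tuple A) (t : M.*2.-1.-tuple A) :
    val t = a ++ window x (1 - n%:Z) q ++ b -> h t = (a, b).
  move=> e; rewrite /h /= e take_size_cat ?drop_size_cat ?size_tuple //.
  by rewrite ?drop_size_cat ?size_window // !valKd.
have cE : (#|E| <= Nwords X p * Nwords X p)%N.
  rewrite -(card_in_imset (f := h)); last first.
    move=> s t /EP[a [b [_ _ es]]] /EP[a' [b' [_ _ et]]].
    rewrite (hE _ _ _ es) (hE _ _ _ et) => -[ea eb].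
    by apply: val_inj; rewrite es et ea eb.
  rewrite /Nwords /num_ext -cardsX; apply: subset_leq_card.
  apply/fintype.subsetP => _ /imsetP[t /EP[a [b [wa wb et]]] ->].
  by rewrite (hE _ _ _ et) !inE; apply/andP; split; apply/asboolP.
apply: (@leq_trans (Nwords X p * (Nwords X q * Nwords X p))%N).
  by rewrite mulnCA mulnC leq_mul2l cE orbT.
rewrite -mulnn -mulnA Mpq.
apply: (@leq_trans (gap_const X g * (Nwords X p * Nwords X (q + p)))%N).
  by rewrite [leqRHS]mulnCA leq_mul2l Nwords_mul_le ?orbT.
by rewrite leq_mul2l Nwords_mul_le ?orbT.
Qed.

(** If no J worked, points [y J] of X would escape the first J cylinders. Their cluster point lies
    in some cylinder j, and then so does some [y m] with m > j. *)
Lemma compact_cover (A : finType) (X : set (conf Ztime A))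
    (x : nat -> conf Ztime A) (r : nat -> nat) :
  limit_closed X -> (forall y, X y -> exists j, agree (r j) y (x j)) ->
  exists J, forall y, X y -> exists2 j, (j < J)%N & agree (r j) y (x j).
Proof.
move=> Xcl Xcov; apply: contrapT => /forallNP noJ.
have /choice[y yP] : forall J, exists y,
    X y /\ forall j, (j < J)%N -> ~ agree (r j) y (x j).
  move=> J; have /existsNP[y /not_implyP[Xy yN]] := noJ J.
  by exists y; split=> // j jJ yj; apply: yN; exists j.
have [z zP] := exists_cluster y.
have Xz : X z.
  apply: Xcl => n; have [m _ yz] := zP n 0%N.
  by exists (y m) => //; case: (yP m).
have [j zj] := Xcov z Xz.
have [m jm yz] := zP (r j) j.+1.
by have [_ /(_ j jm)] := yP m; apply; exact: agree_trans zj.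
Qed.
(** * Hausdorff dimension *)

Section SymbDist.
Context {R : realType} {A : finType} (S : {set A}).
Implicit Types (x y : conf Ztime A).
Local Notation m := (#|S|%:R : R).
Local Notation d := (@symb_dist R A S).

Lemma symb_dist_ge x y k :
  x k \in S -> y k \in S -> x k <> y k -> ((m ^- (absz k).+1)%:E <= d x y)%E.
Proof.
move=> xS yS xy; apply: esum_ge; exists [set k]; first by split.
rewrite fsbig_set1 lee_fin -[leLHS]mul1r ler_wpM2r ?invr_ge0 ?exprn_ge0 //.
set p := index _ _; set q := index _ _.
have : p != q.
  apply/eqP => pq; apply: xy.
  rewrite -(nth_index (x k) (s := enum S) (x := x k)) ?mem_enum //.
  rewrite -[RHS](nth_index (x k) (s := enum S)) ?mem_enum //.
  exact: (congr1 (nth (x k) (enum S)) pq).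
rewrite neq_ltn => /orP[pq|pq]; [rewrite distrC|];
  by rewrite ger0_norm ?subr_ge0 ?ler_nat 1?ltnW // lerBrDl natr1 ler_nat.
Qed.

Lemma symb_dist_lt_agree n x y :
  (forall k, x k \in S) -> (forall k, y k \in S) ->
  (d x y < (m ^- n)%:E)%E -> agree n x y.
Proof.
move=> xS yS xy k /= kn; apply: contrapT => xyk.
have m1 : 1 <= m by rewrite ler1n; apply/card_gt0P; exists (x 0).
move: xy; apply/negP; rewrite -leNgt.
apply: le_trans (symb_dist_ge (xS k) (yS k) xyk).
by rewrite lee_fin lef_pV2 ?posrE ?exprn_gt0 ?(lt_le_trans ltr01) // ler_weXn2l.
Qed.

Lemma count_absz_le2 (s : seq int) j :
  uniq s -> (count (fun k => absz k == j) s <= 2)%N.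
Proof.
move=> us; rewrite -size_filter.
apply: (@uniq_leq_size _ _ [:: j%:Z; - j%:Z]); first exact: filter_uniq.
by move=> k; rewrite mem_filter => /andP[/eqP kj _]; rewrite !inE; lia.
Qed.

Lemma symb_dist_agree_le n x y :
  (forall k, x k \in S) -> (forall k, y k \in S) ->
  agree n x y -> (d x y <= (2 * m ^- n)%:E)%E.
Proof.
move=> xS yS xy; apply: ge_ereal_sup => _ [F [finF _] <-].
have m1 : 1 <= m by rewrite ler1n; apply/card_gt0P; exists (x 0).
have m0 : 0 < m := lt_le_trans ltr01 m1.
rewrite fsbig_finite //= sumEFin lee_fin.
set s := fset_set F.
(* Indices differ by at most m - 1, and (m - 1)/m^(j+1) is written as a difference so that the sum
   telescopes to at most m^-n. *)
pose t (j : nat) : R := if (j < n)%N then 0 else m ^- j - m ^- j.+1.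
have t0 j : 0 <= t j.
  rewrite /t; case: ifP => // _; rewrite subr_ge0.
  by rewrite lef_pV2 ?posrE ?exprn_gt0 // ler_weXn2l.
apply: (@le_trans _ _ (\sum_(k <- s) t (absz k))).
  apply: ler_sum => k _; rewrite /t; case: ifPn => [kn|_].
    by rewrite xy // subrr normr0 mul0r.
  have -> : m ^- absz k - m ^- (absz k).+1 = (m - 1) / m ^+ (absz k).+1.
    by rewrite exprS invfM mulrA mulrBl divff ?gt_eqF // mulrBl !mul1r.
  rewrite ler_wpM2r ?invr_ge0 ?exprn_ge0 // lerBrDr.
  have := xS k; have := yS k; rewrite -!(mem_enum S) -!index_mem -cardE.
  set p := index (x k) _; set q := index (y k) _ => pS qS.
  have [pq|pq] := leqP p q; [rewrite distrC|];
    rewrite -natrB ?(ltnW pq) // ger0_norm // natr1 ler_nat;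
    by rewrite (leq_ltn_trans (leq_subr _ _)).
pose M := (\max_(k <- s) absz k)%N.
have sM k : k \in s -> (absz k < M.+1)%N.
  by move=> ks; rewrite ltnS /M (bigD1_seq k) //= leq_maxl.
have tele N : \sum_(j < N) t j <= m ^- n.
  have [Nn|nN] := leqP N n.
    rewrite big1 ?invr_ge0 ?exprn_ge0 // => j _.
    by rewrite /t (leq_trans (ltn_ord j)).
  have -> : \sum_(j < N) t j = m ^- n - m ^- N.
    rewrite -(big_mkord xpredT t) (big_cat_nat (n := n)) //=; last exact: ltnW.
    rewrite big_nat big1 ?add0r; last by move=> j; rewrite /t => /andP[_ ->].
    rewrite big_nat (eq_bigr (fun j => - m ^- j.+1 - - m ^- j)); last first.
      by move=> j /andP[nj _]; rewrite /t ltnNge nj opprK addrC.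
    by rewrite -big_nat telescope_sumr ?(ltnW nN) // opprK addrC.
  by rewrite gerBl invr_ge0 exprn_ge0.
rewrite big_seq.
(* Grouping by |k|: at most two integers share an absolute value, the source of the factor 2. *)
rewrite (partition_big (fun k => inord (absz k) : 'I_M.+1) xpredT) //=.
apply: (@le_trans _ _ (\sum_(j < M.+1) 2 * t j)); last first.
  by rewrite -mulr_sumr ler_pM2l.
apply: ler_sum => j _.
rewrite (eq_bigr (fun=> t j)); last first.
  by move=> k /andP[ks /eqP <-]; rewrite inordK // sM.
rewrite big_const_seq iter_addr_0 -[leLHS]mulr_natl ler_wpM2r // ler_nat.
apply: leq_trans (count_absz_le2 j (fset_uniq s)).
by apply: sub_count => k /andP[ks /eqP <-] /=; rewrite inordK // sM.
Qed.

End SymbDist.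
Section HausdorffFacts.
Context {R : realType} {T : Type} (d : T -> T -> \bar R).
Local Open Scope ereal_scope.

Lemma diam_ge0 U : 0 <= diam d U.
Proof. by apply: ereal_sup_ubound; left. Qed.

Lemma diam_ub U x y : U x -> U y -> d x y <= diam d U.
Proof. by move=> Ux Uy; apply: ereal_sup_ubound; right; exists x => //; exists y. Qed.

Lemma diam_le U (r : R) : (0 <= r)%R ->
  (forall x y, U x -> U y -> d x y <= r%:E) -> diam d U <= r%:E.
Proof.
move=> r0 Ur; apply: ge_ereal_sup => _ [->|[x Ux [y Uy <-]]].
  by rewrite lee_fin.
exact: Ur.
Qed.

Lemma hausdorff_pre_ge0 s delta X : 0 <= hausdorff_pre d s delta X.
Proof.
apply: le_ereal_inf_tmp => _ [U _ <-].
by apply: nneseries_ge0 => j _ _; exact: poweR_ge0.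
Qed.

(** A finite cover is continued by empty sets; these contribute 0 because their diameter is 0 and s
    is positive. *)
Lemma hausdorff_pre_le s delta X n (U : nat -> set T) (r : R) :
  (0 < s)%R -> (0 <= r)%R -> (r <= delta)%R ->
  X `<=` \bigcup_(j < n) U j ->
  (forall j, (j < n)%N -> U j `<=` X /\ diam d (U j) <= r%:E) ->
  hausdorff_pre d s delta X <= (n%:R * r `^ s)%:E.
Proof.
move=> s0 r0 rdelta XU Ur.
pose V j := if (j < n)%N then U j else set0.
have diam0 : diam d set0 = 0.
  by apply/eqP; rewrite eq_le diam_ge0 andbT; apply: diam_le.
have Vr j : diam d (V j) <= r%:E.
  rewrite /V; case: ifPn => [/Ur[]//|_]; by rewrite diam0 lee_fin.
apply: (@le_trans _ _ (\sum_(0 <= j <oo) (diam d (V j) `^ s))).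
  apply: ereal_inf_lbound; exists V => //; split=> [x /XU[j jn Ujx]|j].
    by exists j => //; rewrite /V jn.
  split; last by rewrite (le_trans (Vr j)) // lee_fin.
  by rewrite /V; case: ifPn => [/Ur[]//|_]; exact: sub0set.
rewrite (nneseries_split 0 n) => [|k _]; last exact: poweR_ge0.
rewrite [X in _ + X]eseries0 ?adde0; last first.
  by move=> j nj _; rewrite /V add0n in nj *; rewrite ltnNge nj diam0 poweR0r ?gt_eqF.
rewrite add0n big_mkord.
apply: (@le_trans _ _ (\sum_(j < n) (r `^ s)%:E)).
  apply: lee_sum => j _; rewrite -poweR_EFin.
  apply: gt0_ler_poweR (Vr j); rewrite ?(ltW s0) // in_itv /= leey andbT.
    exact: diam_ge0.
  by rewrite lee_fin.
by rewrite sumEFin lee_fin sumr_const card_ord mulr_natl.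
Qed.

Lemma hausdorff_measure_eq0 s X :
  (forall delta, (0 < delta)%R -> hausdorff_pre d s delta X <= 0) ->
  hausdorff_measure d s X = 0.
Proof.
move=> pre0; apply/eqP; rewrite eq_le; apply/andP; split.
  by apply: ge_ereal_sup => _ [delta /= /pre0 h <-].
apply: (le_trans (hausdorff_pre_ge0 s 1 X)).
by apply: ereal_sup_ubound; exists 1%R => //=.
Qed.

End HausdorffFacts.

(** * Dimension of a closed shift with bounded gaps *)

Section Dimension.
Context {R : realType} {A : finType} (S : {set A}) (X : set (conf Ztime A)).
Hypothesis XS : forall x k, X x -> x k \in S.
Hypothesis X0 : X !=set0.
Hypothesis Xinv : translation_invariant X.
Hypothesis Xcl : limit_closed X.
Variables (g : nat) (L : R).
Hypothesis Xg : gap_bounded X g.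
Hypothesis XL : has_growth X L.
Local Notation m := (#|S|%:R : R).
Local Notation d := (@symb_dist R A S).

Lemma alphabet_gt0 : (0 < #|S|)%N.
Proof. by have [x Xx] := X0; apply/card_gt0P; exists (x 0); exact: XS. Qed.

Lemma expR_lnm n : m ^- n = expR (- (n%:R * ln m)).
Proof.
have m0 : 0 < m by rewrite ltr0n alphabet_gt0.
by rewrite expRN expRM_natl lnK ?posrE.
Qed.

(** The cover by n-cylinders has about exp(2nL) members of diameter at most 2 m^-n, so its s-sum
    decays like exp(-n eta) with eta = s ln m - 2L > 0. *)
Lemma hausdorff_measure_above s :
  0 < s -> 2 * L < s * ln m -> hausdorff_measure d s X = 0%E.
Proof.
move=> s0 Ls; apply: hausdorff_measure_eq0 => delta delta0.
have m0 : 0 < m by rewrite ltr0n alphabet_gt0.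
have lnm0 : 0 < ln m.
  have := growth_ge0 XL; rewrite -(pmulr_rgt0 _ s0); lra.
have [K XK] := XL.
(* K + |L| is the counting error of [half_growth]; s ln 2 comes from the factor 2 in the diameter
   bound. *)
pose C := K + `|L| + s * ln 2.
pose eta := s * ln m - 2 * L.
have eta0 : 0 < eta by rewrite subr_gt0.
have pre_le n : 2 * m ^- n <= delta ->
    (hausdorff_pre d s delta X <= (expR (C - n%:R * eta))%:E)%E.
  move=> ndelta.
  pose P := patterns X (@cwindow A n).
  have [x0 Xx0] := X0.
  pose U j := X `&` @cwindow A n @^-1` [set nth (cwindow n x0) (enum P) j].
  apply: (@le_trans _ _ (#|P|%:R * (2 * m ^- n) `^ s)%:E).
    apply: (@hausdorff_pre_le _ _ _ _ _ _ _ U) => //.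
    - move=> x Xx; have xP : cwindow n x \in P by apply/patternsP; exists x.
      exists (index (cwindow n x) (enum P)) => /=.
        by rewrite cardE index_mem mem_enum.
      by split=> //=; rewrite nth_index // mem_enum.
    - move=> j _; split; first by move=> x [].
      apply: diam_le; first by rewrite mulr_ge0 // invr_ge0 exprn_ge0 // ltW.
      move=> x y [Xx /= xj] [Xy /= yj].
      apply: symb_dist_agree_le => [k|k|]; [exact: XS|exact: XS|].
      by apply/cwindow_agree; rewrite xj yj.
  rewrite lee_fin.
  have -> : (2 * m ^- n) `^ s = expR (s * ln 2 - s * (n%:R * ln m)).
    rewrite expR_lnm -[in LHS](lnK (x := 2)) ?posrE // -expRD -expRM.
    by congr expR; ring.
  rewrite card_patterns //.
  have N0 : 0 < (Nwords X n.*2.-1)%:R :> R by rewrite ltr0n Nwords_gt0.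
  rewrite -[X in X * _](lnK N0) -expRD ler_expR.
  have := half_growth n XK; rewrite ler_norml => /andP[_].
  by rewrite /C /eta; lra.
apply/lee_addgt0Pr => e e0; rewrite add0e.
have lin c (k : R) : 0 < k -> exists n0 : nat, forall n, (n0 <= n)%N -> c <= n%:R * k.
  move=> k0; exists (Num.truncn (c / k)).+1 => n nn.
  rewrite -ler_pdivrMr // (le_trans (ltW (truncnS_gt _))) // ler_nat.
  exact: leq_trans nn.
(* From n1 on the cylinders have diameter at most [delta]; from n2 on the s-sum is at most e. *)
have [n1 Hn1] := lin (ln 2 - ln delta) _ lnm0.
have [n2 Hn2] := lin (C - ln e) _ eta0.
apply: le_trans (pre_le (maxn n1 n2) _) _.
  rewrite expR_lnm -[X in X * _](lnK (x := 2)) ?posrE // -expRD.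
  rewrite -[leRHS](lnK delta0) ler_expR.
  by have := Hn1 _ (leq_maxl n1 n2); lra.
rewrite lee_fin -[leRHS](lnK e0) ler_expR.
by have := Hn2 _ (leq_maxr n1 n2); lra.
Qed.

(** Mass distribution principle by counting. After passing to finitely many cylinders, fix M above
    all radii: a cylinder of radius r holds at most a fraction C exp(-2rL) of the M-windows, and
    together the cylinders hold all of them. *)
Lemma mass_distribution_bound : exists2 C : R, 0 < C &
  forall (x : nat -> conf Ztime A) (r : nat -> nat),
    (forall j, (0 < r j)%N) ->
    (forall y, X y -> exists j, agree (r j) y (x j)) ->
    exists J, 1 <= C * \sum_(j < J) expR (- ((r j)%:R * (2 * L))).
Proof.
have [K XK] := XL; have N0 n := Nwords_gt0 n X0.
have [G G0 HG] : exists2 G, (0 < G)%N & forall n M x, (0 < n <= M)%N ->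
    (#|[set t in patterns X (@cwindow A M) |
         `[< exists2 y, agree n y x & cwindow M y = t >]]%SET|
     * Nwords X n.*2.-1 <= G * Nwords X M.*2.-1)%N.
  exists (gap_const X g ^ 2)%N; first by rewrite expn_gt0 muln_gt0 N0.
  by move=> n M x; exact: card_refinements.
(* G is the loss in [card_refinements]; the exponential is the loss when [Nwords X (r j).*2.-1] is
   replaced by exp(2 (r j) L). *)
pose C := G%:R * expR (K + `|L|); exists C => [|x r r0 Xr].
  by rewrite mulr_gt0 ?expR_gt0 // ltr0n.
have [J XJ] := compact_cover Xcl Xr; exists J.
pose M := (\max_(j < J) r j)%N.
pose E (j : nat) := [set t in patterns X (@cwindow A M) |
  `[< exists2 y, agree (r j) y (x j) & cwindow M y = t >]]%SET.
have PE : (#|patterns X (@cwindow A M)| <= \sum_(j < J) #|E j|)%N.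
  apply: leq_trans (card_bigcup_le _ _); apply: subset_leq_card.
  apply/fintype.subsetP => t /[dup] tP /patternsP[y Xy yt].
  have [j jJ yx] := XJ y Xy; apply/finset.bigcupP; exists (Ordinal jJ) => //.
  by rewrite inE tP; apply/asboolP; exists y.
pose NM := (Nwords X M.*2.-1)%:R : R.
have NM0 : 0 < NM by rewrite ltr0n.
have Ej (j : 'I_J) : #|E j|%:R <= C * NM * expR (- ((r j)%:R * (2 * L))).
  have rM : (0 < r j <= M)%N by rewrite r0 /M (leq_bigmax (F := fun j : 'I_J => r j)).
  have := HG _ _ (x j) rM.
  rewrite -/(E j) -(ler_nat R) !natrM => h.
  set Nj := (Nwords X (r j).*2.-1)%:R in h.
  have Nj0 : 0 < Nj by rewrite ltr0n.
  rewrite -ler_pdivlMr // in h.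
  apply: (le_trans h); rewrite /C -/NM -!mulrA ler_pM2l ?ltr0n //.
  rewrite mulrCA ler_pM2l // -[Nj]lnK // -expRN -expRD ler_expR.
  by have := half_growth (r j) XK; rewrite ler_norml => /andP[]; rewrite -/Nj; lra.
rewrite -(ler_pM2l NM0) mulr1 mulrA (mulrC NM) mulr_sumr /NM -card_patterns //.
apply: (@le_trans _ _ (\sum_(j < J) #|E j|)%N%:R); first by rewrite ler_nat.
by rewrite natr_sum; apply: ler_sum => j _; rewrite card_patterns //; exact: Ej.
Qed.

(** Replaces a covering set by a cylinder of comparable size. The slack e serves sets of very small
    or zero diameter, for which a cylinder of fixed small size is used. *)
Lemma radius_of_diam s (U : set (conf Ztime A)) (D e : R) :
  (1 < #|S|)%N -> 0 < s -> 0 < e -> U `<=` X ->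
  diam d U = D%:E -> 0 <= D -> D < m^-1 ->
  exists n, exists x, [/\ (0 < n)%N, forall y, U y -> agree n y x &
    expR (- (n%:R * (s * ln m))) <= m `^ s * D `^ s + e].
Proof.
move=> S1 s0 e0 UX UD D0 Dm.
have m0 : 0 < m by rewrite ltr0n alphabet_gt0.
have lnm0 : 0 < ln m by rewrite ln_gt0 // ltr1n.
have Dagree n : D < m ^- n -> exists x, forall y, U y -> agree n y x.
  move=> Dn; have [[x Ux]|/set0P/negP/negPn/eqP ->] := pselect (U !=set0); last first.
    by have [x _] := X0; exists x.
  exists x => y Uy; apply: (@symb_dist_lt_agree R A S).
  - by move=> k; exact: XS (UX _ Uy).
  - by move=> k; exact: XS (UX _ Ux).
  - by apply: (le_lt_trans (diam_ub d Uy Ux)); rewrite UD lte_fin.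
have mDs : 0 <= m `^ s * D `^ s by rewrite mulr_ge0 ?powR_ge0.
have [n0 n00 n0e] : exists2 n, (0 < n)%N & expR (- (n%:R * (s * ln m))) <= e.
  exists (Num.truncn (- ln e / (s * ln m))).+1 => //.
  rewrite -[leRHS](lnK e0) ler_expR lerNl -ler_pdivrMr ?mulr_gt0 //.
  exact/ltW/truncnS_gt.
have [Dn0|Dn0] := ltP D (m ^- n0).
  have [x xP] := Dagree _ Dn0; exists n0, x; split=> //.
  by rewrite (le_trans n0e) // lerDr.
have exn : exists n, m ^- n <= D by exists n0.
case: (ex_minnP exn) => -[|[|n]] nD nmin.
- by have := le_lt_trans nD Dm; rewrite expr0 invr1 ltNge invf_le1 // ler1n alphabet_gt0.
- by have := le_lt_trans nD Dm; rewrite expr1 ltxx.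
have [x xP] := Dagree n.+1 (ltac:(rewrite ltNge; apply/negP => /nmin; rewrite ltnn //)).
exists n.+1, x; split=> //.
apply: (@le_trans _ _ (m `^ s * D `^ s)); last by rewrite lerDl ltW.
rewrite -powRM ?(ltW m0) //.
have -> : - (n.+1%:R * (s * ln m)) = - (n.+1%:R * ln m) * s by ring.
rewrite expRM -expR_lnm.
apply: ge0_ler_powR; rewrite ?nnegrE ?(ltW s0) ?mulr_ge0 ?(ltW m0) //.
by rewrite -ler_pdivrMl // -invfM -exprS.
Qed.

Lemma hausdorff_measure_below s : (1 < #|S|)%N ->
  0 < s -> s * ln m <= 2 * L -> hausdorff_measure d s X != 0%E.
Proof.
move=> S1 s0 sL.
have m0 : 0 < m by rewrite ltr0n alphabet_gt0.
have [C C0 HC] := mass_distribution_bound.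
(* Strictly below 1/m, as [radius_of_diam] demands. *)
pose delta := m^-1 / 2.
have delta0 : 0 < delta by rewrite divr_gt0 ?invr_gt0.
pose c := (2 * C * m `^ s)^-1.
have ms0 : 0 < m `^ s by rewrite powR_gt0.
have c0 : 0 < c by rewrite invr_gt0 !mulr_gt0.
suff cpre : (c%:E <= hausdorff_pre d s delta X)%E.
  rewrite gt_eqF // (@lt_le_trans _ _ c%:E) ?lte_fin //.
  by apply: (le_trans cpre); apply: ereal_sup_ubound; exists delta.
apply: le_ereal_inf_tmp => _ [U [XU Udelta] <-].
have /choice[D DP] j : exists D : R,
    [/\ diam d (U j) = D%:E, 0 <= D & D < m^-1].
  have [_] := Udelta j; have := diam_ge0 d (U j).
  case: (diam d (U j)) => [D| |] //; rewrite !lee_fin => D0 Ddelta.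
  exists D; split => //; apply: (le_lt_trans Ddelta).
  by rewrite /delta ltr_pdivrMr // ltr_pMr ?invr_gt0 // ltr1n.
(* The slacks sum to at most 1/(4C), so they absorb only a quarter of the unit mass; the s-sum is
   then at least 3/(4 C m^s), above c. *)
pose e j : R := (4 * C)^-1 / 2 ^+ j.+1.
have e0 j : 0 < e j by rewrite divr_gt0 ?invr_gt0 ?mulr_gt0 ?exprn_gt0.
have /choice[r /choice[x rxP]] j : exists n, exists x, [/\ (0 < n)%N,
    forall y, U j y -> agree n y x &
    expR (- (n%:R * (s * ln m))) <= m `^ s * D j `^ s + e j].
  have [UD D0 Dm] := DP j; have [UX _] := Udelta j.
  exact: radius_of_diam UX UD D0 Dm.
have [|y Xy|J HJ] := HC x r; first by move=> j; case: (rxP j).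
  by have [j _ Ujy] := XU y Xy; exists j; case: (rxP j) => _ + _; apply.
apply: le_trans (nneseries_lim_ge J _); last by move=> j _ _; exact: poweR_ge0.
under eq_bigr => j _ do rewrite (let: And3 h _ _ := DP j in h) poweR_EFin.
rewrite sumEFin lee_fin big_mkord.
have esum : \sum_(j < J) e j <= (4 * C)^-1.
  have -> : \sum_(j < J) e j = (4 * C)^-1 * (1 - 2^-1 ^+ J).
    elim: J {HJ} => [|J IH]; first by rewrite big_ord0 expr0 subrr mulr0.
    rewrite big_ord_recr /= IH /e -exprVn exprS; field.
    by rewrite gt_eqF.
  by rewrite ler_piMr ?invr_ge0 ?mulr_ge0 ?ltW // gtrBl ?exprn_gt0 ?invr_gt0.
have h : 1 <= C * (m `^ s * \sum_(j < J) D j `^ s + (4 * C)^-1).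
  apply: (le_trans HJ); rewrite ler_pM2l //.
  apply: le_trans (lerD (lexx _) esum); rewrite mulr_sumr -big_split /=.
  apply: ler_sum => j _; have [_ _] := rxP j; apply: le_trans.
  by rewrite ler_expR lerN2 ler_wpM2l.
rewrite /c -mulrA invfM ler_pdivrMr ?mulr_gt0 // mulrC -mulrA.
have C4 : C * (4 * C)^-1 = 4^-1 by field; rewrite gt_eqF.
by move: h; rewrite mulrDr C4; lra.
Qed.

Lemma dimH_growth : dimH R S X = (2 * L / ln m)%:E.
Proof.
have L0 := growth_ge0 XL.
have m1 : 1 <= m by rewrite ler1n alphabet_gt0.
have lnm0 : 0 <= ln m := ln_ge0 m1.
apply/eqP; rewrite eq_le; apply/andP; split; last first.
  apply: le_ereal_inf_tmp => _ [s [s0 Hs] <-]; rewrite lee_fin.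
  (* With one symbol, ln m = 0 and the quotient is 0 because the inverse of 0 is 0; this is the
     correct dimension of a point. *)
  have [S1|S1] := ltnP 1 #|S|; last first.
    have -> : #|S| = 1%N by apply/eqP; rewrite eqn_leq S1 alphabet_gt0.
    by rewrite ln1 invr0 mulr0 ltW.
  have lnm : 0 < ln m by rewrite ln_gt0 // ltr1n.
  rewrite ler_pdivrMr // leNgt; apply/negP => sL.
  by have := hausdorff_measure_below S1 s0 (ltW sL); rewrite Hs eqxx.
have Lm0 : 0 <= 2 * L / ln m by rewrite divr_ge0 // mulr_ge0.
apply/lee_addgt0Pr => e e0; rewrite -EFinD; apply: ereal_inf_lbound.
exists (2 * L / ln m + e) => //; split; first by rewrite ltr_wpDl.
have [S1|S1] := ltnP 1 #|S|.
  have lnm : 0 < ln m by rewrite ln_gt0 // ltr1n.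
  apply: hausdorff_measure_above; first by rewrite ltr_wpDl.
  by rewrite [ltRHS]mulrDl divfK ?gt_eqF // ltrDl mulr_gt0.
(* One symbol only: X is a single point, and X itself is a cover of diameter 0. *)
have Sx x y k : X x -> X y -> x k = y k.
  by move=> Xx Xy; apply: (elimT card_le1_eqP S1); exact: XS.
have s0 : 0 < 2 * L / ln m + e by rewrite ltr_wpDl.
apply: hausdorff_measure_eq0 => delta delta0.
have := @hausdorff_pre_le _ _ d _ delta X 1 (fun=> X) 0 s0 (lexx _) (ltW delta0).
rewrite powR0 ?gt_eqF // mulr0; apply; first by move=> x Xx; exists 0%N.
move=> _ _; split=> //; apply: diam_le => // x y Xx Xy.
rewrite /symb_dist esum1 // => k _.
by rewrite (Sx x y k Xx Xy) subrr normr0 mul0r.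
Qed.

End Dimension.
(** * Measures on shifts *)

Section BorelCylinders.
Context {A : pfinType}.

Lemma open_coord (k : int) (a : A) : open [set x : conf Ztime A | x k = a].
Proof.
rewrite openE => x xa; rewrite /interior.
by apply: filterS (coord_nbhs x k) => y /= ->.
Qed.

Lemma measurable_coord (k : int) (a : A) :
  measurable ([set x | x k = a] : set (borel Ztime A)).
Proof. by apply: sub_sigma_algebra; exact: open_coord. Qed.

Lemma measurable_window (k : int) (u : seq A) :
  measurable ([set x | window x k (size u) = u] : set (borel Ztime A)).
Proof.
elim: u k => [|a u IH] k.
  rewrite [X in measurable X](_ : _ = setT); first exact: measurableT.
  by apply/seteqP; split.
rewrite [X in measurable X](_ : _ =
    [set x : borel Ztime A | x k = a] `&`
    [set x : borel Ztime A | window x (k + 1) (size u) = u]).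
  by apply: measurableI; [exact: measurable_coord|exact: IH].
apply/seteqP; split=> x /=; rewrite -add1n window_add window1 /=.
  by move=> [-> ->].
by move=> [-> ->].
Qed.

Lemma measurable_cwindow n (t : n.*2.-1.-tuple A) :
  measurable (@cwindow A n @^-1` [set t] : set (borel Ztime A)).
Proof.
rewrite [X in measurable X](_ : _ = 
    [set x : borel Ztime A | window x (1 - n%:Z) (size t) = t]).
  exact: measurable_window.
apply/seteqP; split=> x /=; rewrite size_tuple => h; first by rewrite -h.
exact: val_inj.
Qed.

(** The filter generated by the cylinders around x converges to x in the product topology, so it
    contains every neighbourhood. *)
Lemma nbhs_agree (x : conf Ztime A) (U : set (conf Ztime A)) :
  nbhs x U -> exists n, forall y, agree n y x -> U y.
Proof.
pose F : set_system (conf Ztime A) :=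
  [set P | exists n, forall y, agree n y x -> P y].
have FF : Filter F.
  split; first by exists 0%N.
    move=> P Q [n Pn] [p Qp]; exists (maxn n p) => y yx; split.
      by apply: Pn; apply: agree_le yx; exact: leq_maxl.
    by apply: Qp; apply: agree_le yx; exact: leq_maxr.
  by move=> P Q PQ [n Pn]; exists n => y /Pn /PQ.
apply: (conf_cvg FF) => k; exists (absz k).+1 => y yx; exact: yx.
Qed.

(** Every open set is a countable union of cylinders, as there are finitely many of each length; so
    the coordinates generate the Borel sets. *)
Lemma measurable_fun_conf d (T : measurableType d) (f : T -> borel Ztime A) :
  (forall k a, measurable (f @^-1` [set x | x k = a])) ->
  measurable_fun setT f.
Proof.
move=> fc.
have fw n (t : n.*2.-1.-tuple A) :
    measurable (f @^-1` (@cwindow A n @^-1` [set t])).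
  rewrite [X in measurable X](_ : _ = \bigcap_(j in [set: 'I_n.*2.-1])
      (f @^-1` [set x | x (1 - n%:Z + (j : nat)%:Z) = tnth t j])).
    by apply: fin_bigcap_measurable => // j _; exact: fc.
  apply/seteqP; split=> x /= h.
    by move=> j _ /=; rewrite -h /tnth nth_window.
  apply: eq_from_tnth => j; rewrite (tnth_nth (f x 0)) /= nth_window //.
  exact: (h j I).
move=> _ E mE; rewrite setTI.
have : <<s @open (conf Ztime A) >> E by [].
pose G : set (set (conf Ztime A)) := [set E | measurable (f @^-1` E)].
suff : <<s @open (conf Ztime A) >> `<=` G by apply.
apply: smallest_sub; rewrite /G.
  split=> /=.
  - by rewrite preimage_set0; exact: measurable0.
  - by move=> U GU; rewrite setTD preimage_setC; exact: measurableC.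
  - by move=> F GF; rewrite preimage_bigcup; exact: bigcupT_measurable.
move=> U oU /=.
rewrite [X in measurable X](_ : _ = \bigcup_n
    \bigcup_(t in [set t | @cwindow A n @^-1` [set t] `<=` U])
      (f @^-1` (@cwindow A n @^-1` [set t]))).
  apply: bigcupT_measurable => n; apply: fin_bigcup_measurable => //.
  exact: finite_finset.
apply/seteqP; split=> x /=.
  move=> Ufx; have [n nU] := nbhs_agree (open_nbhs_nbhs (conj oU Ufx)).
  exists n => //; exists (cwindow n (f x)) => //= y /= yx.
  by apply: nU; exact/cwindow_agree.
by move=> [n _ [t tU xt]]; exact: tU.
Qed.

Lemma measurable_limit_closed (X : set (conf Ztime A)) :
  limit_closed X -> measurable (X : set (borel Ztime A)).
Proof.
move=> Xcl; rewrite [X in measurable X](_ : _ = \bigcap_n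
   \bigcup_(t in [set` patterns X (@cwindow A n)]) (@cwindow A n @^-1` [set t])).
  apply: bigcapT_measurable => n; apply: fin_bigcup_measurable.
    exact: finite_finpred.
  by move=> t _; exact: measurable_cwindow.
apply/seteqP; split=> x.
  by move=> Xx n _; exists (cwindow n x) => //=; apply/patternsP; exists x.
move=> h; apply: Xcl => n; have [t /= /patternsP[y Xy <-] /= xy] := h n I.
by exists y => //; apply/cwindow_agree; rewrite xy.
Qed.

Lemma measurable_shift (E : set (borel Ztime A)) : measurable E ->
  measurable (@shift_map Ztime A @^-1` E : set (borel Ztime A)).
Proof.
move=> mE; rewrite -[X in measurable X]setTI.
apply: (@measurable_fun_conf _ (borel Ztime A) (@shift_map Ztime A)) => //.
by move=> k a; exact: (measurable_coord (k + 1) a).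
Qed.

End BorelCylinders.

Section Probability.
Context d (T : measurableType d) (R : realType) (mu : probability T R).

Lemma prob_setI1 (E F : set T) :
  measurable E -> measurable F -> mu F = 1%E -> mu (E `&` F) = mu E.
Proof.
move=> mE mF F1.
have CF0 : mu (~` F) = 0%E by rewrite probability_setC // F1 subee.
have CEF0 : mu (E `&` ~` F) = 0%E.
  apply/eqP; rewrite -measure_le0 -CF0 le_measure ?inE //.
    by apply: measurableI => //; exact: measurableC.
  exact: measurableC.
rewrite -[in RHS](setIT E) -(setUv F) setIUr measureU0 //; first exact: measurableI.
by apply: measurableI => //; exact: measurableC.
Qed.

Lemma prob_partition (J : finType) (f : T -> J) (P : {set J}) (D : set T) :
  measurable D -> (forall t, measurable (f @^-1` [set t])) ->
  (forall x, D x -> f x \in P) ->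
  fine (mu D) = \sum_(t in P) fine (mu (D `&` f @^-1` [set t])).
Proof.
move=> mD mf DP.
rewrite [in LHS](_ : D = \bigcup_(t in [set` P]) (D `&` f @^-1` [set t])).
  rewrite measure_fin_bigcup //; last 2 first.
  - by move=> s t _ _ [x [[_ /= <-] [_ /= <-]]].
  - by move=> t _; exact: measurableI.
  rewrite -(bigfs _ (index_enum_uniq J)) => [|t _]; last by rewrite mem_index_enum.
  rewrite -sum_fine // => t _; apply: fin_num_measure; exact: measurableI.
apply/seteqP; split=> [x Dx|x [t _ []]//].
by exists (f x) => //=; exact: DP.
Qed.
End Probability.
(** * Entropy *)

Section FiniteEntropy.
Context {R : realType}.
Implicit Types q : R.

Lemma ent_le q : 0 <= q -> - (q * ln q) <= 1 - q.
Proof.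
rewrite le_eqVlt => /predU1P[<-|q0]; first by rewrite mul0r oppr0 addr0.
have := expR_ge1Dx (- ln q); rewrite expRN lnK ?posrE // => h.
have : q * (1 + - ln q) <= q * q^-1 by rewrite ler_pM2l.
by rewrite divff ?gt_eqF // mulrDr mulr1 mulrN; lra.
Qed.

(** Gibbs inequality against the constant weight q/c, where q is the total mass. The mass need not
    be 1, so the bound applies to a single fibre or to part of a partition. *)
Lemma ent_sum_le (T : finType) (D : pred T) (p : T -> R) (c : R) :
  (forall t, D t -> 0 <= p t) -> (\sum_(t | D t) 1) <= c ->
  \sum_(t | D t) - (p t * ln (p t)) <=
  - ((\sum_(t | D t) p t) * ln (\sum_(t | D t) p t))
    + (\sum_(t | D t) p t) * ln c.
Proof.
move=> p0; set q := \sum_(t | D t) p t => Dc.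
have : 0 <= q by exact: sumr_ge0.
rewrite le_eqVlt => /predU1P[q0|q0].
  rewrite -q0 !mul0r oppr0 addr0 big1 // => t Dt.
  have pt0 : p t = 0 by exact: (psumr_eq0P p0 (esym q0) Dt).
  by rewrite pt0 mul0r oppr0.
have c0 : 0 < c.
  apply: lt_le_trans Dc; rewrite lt_neqAle sumr_ge0 // andbT.
  apply/eqP => /esym/psumr_eq0P D0; move: q0; rewrite /q big1 ?ltxx // => t Dt.
  by have /eqP := D0 (fun _ _ => ler01) t Dt; rewrite oner_eq0.
(* This is exp(x) >= 1 + x at x = ln (q/c) - ln (p t), multiplied by p t. *)
have step t : D t -> - (p t * ln (p t)) + p t * ln (q / c) <= q / c - p t.
  move=> Dt; have := p0 t Dt; rewrite le_eqVlt => /predU1P[<-|pt0].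
    by rewrite !mul0r oppr0 !addr0 divr_ge0 // ltW.
  have qc0 : 0 < q / c by rewrite divr_gt0.
  have := expR_ge1Dx (ln (q / c) - ln (p t)).
  rewrite expRD expRN !lnK ?posrE // => h.
  have : p t * (1 + (ln (q / c) - ln (p t))) <= p t * (q / c / p t).
    by rewrite ler_pM2l.
  by rewrite [leRHS]mulrC divfK ?gt_eqF // !mulrDr mulr1 mulrN; lra.
have := ler_sum (index_enum T) step; rewrite !big_split /= -mulr_suml -/q.
rewrite !sumrN -/q lnM ?posrE ?invr_gt0 // lnV ?posrE //.
have -> : \sum_(t | D t) q / c = q / c * \sum_(t | D t) 1.
  by rewrite mulr_sumr; apply: eq_bigr => t _; rewrite mulr1.
have : q / c * \sum_(t | D t) 1 <= q.
  apply: (@le_trans _ _ (q / c * c)); last by rewrite divfK ?gt_eqF.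
  by rewrite ler_pM2l // divr_gt0.
rewrite mulrBr; lra.
Qed.

Lemma ent_sum_ge (T : finType) (D : pred T) (p : T -> R) :
  (forall t, D t -> 0 <= p t) ->
  - ((\sum_(t | D t) p t) * ln (\sum_(t | D t) p t)) <=
  \sum_(t | D t) - (p t * ln (p t)).
Proof.
move=> p0; rewrite -mulNr -sumrN mulr_suml; apply: ler_sum => t Dt.
rewrite mulNr lerN2; have := p0 t Dt; rewrite le_eqVlt => /predU1P[<-|pt0].
  by rewrite !mul0r.
rewrite ler_pM2l // ler_ln ?posrE //.
  by rewrite (bigD1 t) //= lerDl sumr_ge0 // => s /andP[Ds _]; exact: p0.
apply: (lt_le_trans pt0).
by rewrite (bigD1 t) //= lerDl sumr_ge0 // => s /andP[Ds _]; exact: p0.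
Qed.

Lemma ent_sum_prob_le (T : finType) (D : {set T}) (p : T -> R) :
  (forall t, t \in D -> 0 <= p t) -> \sum_(t in D) p t = 1 ->
  \sum_(t in D) - (p t * ln (p t)) <= ln #|D|%:R.
Proof.
move=> p0 p1; apply: (le_trans (ent_sum_le p0 (lexx _))).
by rewrite p1 sumr_const !mul1r ln1 oppr0 add0r.
Qed.

(** Mass q on a set smaller by the factor exp(-b) lowers the entropy by bq. The 1 bounds the entropy
    of the split itself: -q ln q <= 1 - q and -(1 - q) ln (1 - q) <= q. *)
Lemma ent_split_le (T : finType) (D E : {set T}) (p : T -> R) (b : R) (N : nat) :
  (forall t, t \in D -> 0 <= p t) -> \sum_(t in D) p t = 1 ->
  (#|D| <= N)%N -> 0 <= b ->
  #|D :&: E|%:R <= expR (- b) * N%:R :> R ->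
  \sum_(t in D) - (p t * ln (p t)) <=
    1 + ln N%:R - b * \sum_(t in D :&: E) p t.
Proof.
move=> p0 p1 DN b0 Eb.
have N0 : (0 < N)%N.
  apply: leq_trans DN; rewrite lt0n; apply/negP => /eqP/cards0_eq D0.
  by move/eqP: p1; rewrite D0 big_set0 eq_sym oner_eq0.
set q := \sum_(t in D :&: E) p t.
have split f : \sum_(t in D) f t =
    \sum_(t in D :&: E) f t + \sum_(t in D :\: E) f t :> R.
  by rewrite (big_setID E).
have q0 : 0 <= q by apply: sumr_ge0 => t; rewrite inE => /andP[/p0].
have pE t : t \in D :&: E -> 0 <= p t by rewrite inE => /andP[/p0].
have pnE t : t \in D :\: E -> 0 <= p t by rewrite inE => /andP[_ /p0].
have q'E : \sum_(t in D :\: E) p t = 1 - q by rewrite -p1 split addrC addKr.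
have q'0 : 0 <= 1 - q by rewrite -q'E; exact: sumr_ge0.
rewrite split.
have h1 := ent_sum_le pE (c := expR (- b) * N%:R).
have h2 := ent_sum_le pnE (c := N%:R).
rewrite -/q in h1; rewrite q'E in h2.
have {}h1 := h1 ltac:(by rewrite sumr_const).
have {}h2 := h2 ltac:(by rewrite sumr_const ler_nat (leq_trans _ DN) //
  subset_leq_card // subsetDl).
rewrite lnM ?posrE ?expR_gt0 ?ltr0n // expRK in h1.
have e1 := ent_le q0; have e2 := ent_le q'0.
rewrite mulrBl mul1r in h2; rewrite mulrDr in h1.
lra.
Qed.

End FiniteEntropy.

(** * Block entropies and maximality *)

Section BlockEntropy.
Context {R : realType} {A : pfinType}.
Implicit Types (X : set (conf Ztime A)) (mu : probability (borel Ztime A) R).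

Definition block_prob X mu n (t : n.*2.-1.-tuple A) : R :=
  fine (mu (X `&` @cwindow A n @^-1` [set t])).

Definition block_entropy X mu n : R :=
  \sum_(t in patterns X (@cwindow A n))
    - (block_prob X mu t * ln (block_prob X mu t)).

Lemma block_prob_ge0 X mu n (t : n.*2.-1.-tuple A) : 0 <= block_prob X mu t.
Proof. exact: fine_ge0. Qed.

Lemma sum_block_prob X mu n : limit_closed X -> mu X = 1%E ->
  \sum_(t in patterns X (@cwindow A n)) block_prob X mu t = 1.
Proof.
move=> Xcl X1; rewrite /block_prob.
rewrite -(@prob_partition _ _ _ mu _ (@cwindow A n)) ?X1 //.
- exact: measurable_limit_closed.
- by move=> t; exact: measurable_cwindow.
- by move=> x Xx; apply/patternsP; exists x.
Qed.

Lemma entropyE X mu :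
  entropy X mu = - lim ((fun n : nat => n%:R^-1 * - block_entropy X mu n) @ \oo).
Proof.
rewrite /entropy; congr (- lim (_ @ \oo)); apply/funext => n.
by rewrite (sum_cylinders X (@cwindow_agree A n)) /block_entropy sumrN opprK.
Qed.

Lemma entropy_cvg X mu (l : R) :
  (fun n : nat => n%:R^-1 * block_entropy X mu n) @ \oo --> l ->
  entropy X mu = l.
Proof.
move=> h; rewrite entropyE -[RHS]opprK; congr (- _).
apply: cvg_lim => //; rewrite [X in X @ _](_ : _ =
    (fun n => - (n%:R^-1 * block_entropy X mu n))); first exact: cvgN.
by apply/funext => n; rewrite mulrN.
Qed.

Variables (X : set (conf Ztime A)) (L : R).
Hypothesis Xinv : translation_invariant X.
Hypothesis Xcl : limit_closed X.
Hypothesis XL : has_growth X L.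

Lemma cvg_Nwords :
  (fun n : nat => n%:R^-1 * ln (Nwords X n.*2.-1)%:R) @ \oo --> 2 * L.
Proof.
have [K XK] := XL; apply: (@cvg_linear_growth _ _ _ (K + `|L|)) => n.
exact: (half_growth n XK).
Qed.

Lemma block_entropy_ge0 mu n : mu X = 1%E -> 0 <= block_entropy X mu n.
Proof.
move=> X1; have := @ent_sum_ge R _ (mem (patterns X (@cwindow A n)))
  (block_prob X mu (n := n)) (fun t _ => block_prob_ge0 X mu t).
by rewrite /= sum_block_prob // ln1 mulr0 oppr0.
Qed.

Lemma block_entropy_le mu n : mu X = 1%E ->
  block_entropy X mu n <= ln (Nwords X n.*2.-1)%:R.
Proof.
move=> X1; rewrite -card_patterns //; apply: ent_sum_prob_le => [t _|].
  exact: block_prob_ge0.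
exact: sum_block_prob.
Qed.

(* If the limit defining [entropy] did not exist, [lim] would return the junk
   value 0, the topological entropy would vanish and squeeze the sequence. *)
Lemma Mmax_cvg mu : Mmax R X mu ->
  (fun n : nat => n%:R^-1 * block_entropy X mu n) @ \oo --> 2 * L.
Proof.
move=> [[X1 _]]; rewrite (top_entropyZ Xinv XL) entropyE.
set u := fun n => _.
have [cu|ncu] := pselect (cvg (u @ \oo)).
  move=> <-; rewrite [X in X @ _](_ : _ = (fun n => - u n)); first exact: cvgN.
  by apply/funext => n; rewrite /u mulrN opprK.
rewrite dvgP // oppr0 => L0; rewrite -L0.
apply: (@squeeze_cvgr _ _ _ _ (fun=> 0) (fun n => n%:R^-1 * ln (Nwords X n.*2.-1)%:R)).
- apply: nearW => n; rewrite mulr_ge0 ?invr_ge0 ?block_entropy_ge0 //=.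
  by rewrite ler_wpM2l ?invr_ge0 // block_entropy_le.
- exact: cvg_cst.
- by rewrite L0; exact: cvg_Nwords.
Qed.

(** The upper bound by the logarithm of the number of windows is automatic and has the same rate 2L,
    so the block entropies are squeezed. *)
Lemma Mmax_of_lower_bound mu (h : nat -> R) :
  invariant_measure X mu -> (forall n, h n <= block_entropy X mu n) ->
  (fun n : nat => n%:R^-1 * h n) @ \oo --> 2 * L -> Mmax R X mu.
Proof.
move=> inv hle hL; split=> //; rewrite (top_entropyZ Xinv XL).
apply: entropy_cvg; apply: squeeze_cvgr hL cvg_Nwords.
apply: nearW => n; have [X1 _] := inv.
by rewrite !ler_wpM2l ?invr_ge0 // block_entropy_le.
Qed.

End BlockEntropy.
(** * Occurrences of a word *)

Section AvoidWord.
Context {A : finType} (X : set (conf Ztime A)) (g : nat) (w : seq A).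
Hypothesis Xg : gap_bounded X g.
Hypothesis Xw : word X w.

Definition avoid (u : seq A) (n : nat) : nat :=
  #|[set v : n.-tuple A | `[< word X (u ++ v) >] && ~~ infix w v]%SET|.

Lemma avoid_sum u n :
  avoid u n =
  (\sum_(v : n.-tuple A | `[< word X (u ++ v) >] && ~~ infix w v) 1)%N.
Proof. by rewrite sum1_card; apply: eq_card => v; rewrite inE. Qed.

(** Only an inequality: w may straddle the junction of the two blocks without occurring in
    either. *)
Lemma avoid_add_le u m n :
  (avoid u (m + n) <= \sum_(v : m.-tuple A |
     `[< word X (u ++ v) >] && ~~ infix w v) avoid (u ++ v) n)%N.
Proof.
rewrite avoid_sum.
rewrite (sum_tuple_cat _ _ (fun z => `[< word X (u ++ z) >] && ~~ infix w z)).
rewrite [leqRHS]big_mkcond; apply: leq_sum => v _; rewrite avoid_sum.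
case: ifPn => [_|nv].
  rewrite big_mkcond [leqRHS]big_mkcond; apply: leq_sum => z _.
  rewrite catA; case: ifPn => // /andP[-> wz].
  rewrite (contra _ wz) // => wz'.
  exact: infix_trans wz' (infix_catl _ (infix_refl _)).
rewrite big_pred0 // => z; apply: contraNF nv; rewrite catA => /andP[/asboolP uvz wz].
apply/andP; split; first by apply/asboolP; exact: word_prefix uvz.
by apply: contra wz => wv; apply: infix_trans wv (infix_catr _ (infix_refl _)).
Qed.

(** Long enough for a gap of at most g letters followed by w. *)
Let B := (size w + g).+1.
(** After any word, a block containing w carries at least the fraction
    1/([Nwords X B * gap_const X g]) of the continuations. The two extra units keep [avoid_const.-1]
    positive, so that the ratio has a positive logarithm. *)
Definition avoid_const := (Nwords X B * gap_const X g).+2.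

(* After every word some extension by [B] letters contains [w]. *)
Lemma avoid_block u n : word X u ->
  (avoid_const * \sum_(v : B.-tuple A |
      `[< word X (u ++ v) >] && ~~ infix w v) num_ext X (u ++ v) n
   <= avoid_const.-1 * num_ext X u (B + n))%N.
Proof.
move=> wu; have [x xg uxw] := Xg wu Xw.
have [y uxwy] := word_extend (B - (size x + size w)) uxw.
have sv : size (x ++ w ++ y) == B.
  rewrite !size_cat size_tuple addnA subnKC //.
  by rewrite /B addnC leqW // leq_add2l.
pose v0 := Tuple sv; have uv0 : word X (u ++ v0) by rewrite /= -!catA in uxwy *.
have h : (num_ext X u (B + n) <= avoid_const.-1 * num_ext X (u ++ v0) n)%N.
  apply: (leq_trans (ext_le _ _ _)); apply: (leq_trans (Nwords_add_le _ _ _)).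
  apply: (@leq_trans (Nwords X B * (gap_const X g * num_ext X (u ++ v0) n))%N).
    by rewrite leq_mul2l ext_ge ?orbT.
  by rewrite mulnA leq_mul2r leqnSn orbT.
(* The block [v0] contains w, so its continuations are disjoint from those of the avoiding
   blocks. *)
have : (num_ext X (u ++ v0) n + \sum_(v : B.-tuple A |
     `[< word X (u ++ v) >] && ~~ infix w v) num_ext X (u ++ v) n
    <= num_ext X u (B + n))%N.
  rewrite ext_add [leqRHS](bigD1 v0) /=; last exact/asboolP.
  rewrite leq_add2l big_mkcond [leqRHS]big_mkcond; apply: leq_sum => v _.
  case: ifPn => // /andP[-> wv] /=; case: ifPn => // /negPn/eqP vv0.
  move: wv; rewrite vv0 /= infix_catl // infix_catr //; exact: infix_refl.
move: h; set s := (\sum_(_ | _) _)%N; set e0 := num_ext _ (u ++ v0) n.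
rewrite /avoid_const /=; set D := (Nwords X B * _).+1; set e := num_ext _ _ _.
move=> h1 h2; have : (D * (e0 + s) <= D * e)%N by rewrite leq_mul2l h2 orbT.
by rewrite mulnDr mulSn; lia.
Qed.

(** Each block of B letters costs another factor [avoid_const.-1]/[avoid_const]. The prefix u is
    general because it grows in the induction. *)
Lemma avoid_le k u n :
  (avoid_const ^ k * avoid u (k * B + n)
   <= avoid_const.-1 ^ k * num_ext X u (k * B + n))%N.
Proof.
elim: k u => [|k IH] u.
  rewrite !mul1n; apply: subset_leq_card; apply/fintype.subsetP => v.
  by rewrite [v \in _]inE [v \in _]inE => /andP[-> _].
have [wu|nwu] := pselect (word X u); last first.
  rewrite /avoid (_ : [set _ | _]%SET = finset.set0) ?cards0 ?muln0 //.
  by apply/setP => v; rewrite !inE; apply/andP => -[/asboolP/word_prefix].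
rewrite mulSn -addnA.
apply: (@leq_trans (avoid_const * (avoid_const.-1 ^ k * \sum_(v : B.-tuple A |
      `[< word X (u ++ v) >] && ~~ infix w v) num_ext X (u ++ v) (k * B + n)))%N).
  rewrite expnS -mulnA leq_mul2l /=.
  apply: (@leq_trans (avoid_const ^ k * \sum_(v : B.-tuple A |
      `[< word X (u ++ v) >] && ~~ infix w v) avoid (u ++ v) (k * B + n))%N).
    by rewrite leq_mul2l avoid_add_le orbT.
  by rewrite !big_distrr /=; apply: leq_sum => v _; exact: IH.
rewrite mulnCA expnSr -mulnA leq_mul2l avoid_block ?orbT //.
Qed.

End AvoidWord.

Lemma infix_window (A : choiceType) (x : conf Ztime A) k n w :
  infix w (window x k n) -> exists j, window x j (size w) = w.
Proof.
move=> /infixP[s1 [s2 e]].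
have : n = (size s1 + (size w + size s2))%N.
  by rewrite -(size_window x k n) e !size_cat.
move=> n12; exists (k + (size s1)%:Z); move: e; rewrite n12 !window_add.
move=> /eqP; rewrite eqseq_cat ?size_window // => /andP[_].
by rewrite eqseq_cat ?size_window // => /andP[/eqP].
Qed.

(** * Recurrence into the past under a maximal measure *)

Section Recurrence.
Context {R : realType} {A : pfinType} (X : set (conf Ztime A)) (g : nat) (L : R).
Hypothesis Xinv : translation_invariant X.
Hypothesis Xcl : limit_closed X.
Hypothesis Xg : gap_bounded X g.
Hypothesis XL : has_growth X L.
Variables (mu : probability (borel Ztime A) R) (w : seq A).
Hypothesis Xmu : Mmax R X mu.
Hypothesis Xw : word X w.

Let X1 : mu X = 1%E.
Proof. by have [[]] := Xmu. Qed.

Let occ (k : int) : set (borel Ztime A) := [set x | window x k (size w) = w].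

Let mocc k : measurable (occ k).
Proof. exact: measurable_window. Qed.

Let never : set (borel Ztime A) := \bigcap_j (~` occ j%:Z `&` ~` occ (- j%:Z)).

Let mnever : measurable never.
Proof.
by apply: bigcapT_measurable => j; apply: measurableI; exact: measurableC.
Qed.

Let neverP x k : never x -> ~ occ k x.
Proof.
move=> nx; have [np nn] := nx (absz k) I.
by have [e|e] : k = absz k \/ k = - (absz k)%:Z by [lia]; rewrite e.
Qed.

Let B := (size w + g).+1.
Let D := avoid_const X g w.
(** The entropy lost per block of B letters by avoiding w. *)
Let beta : R := ln (D%:R / D.-1%:R).

Let beta0 : 0 < beta.
Proof.
rewrite /beta ln_gt0 // ltr_pdivlMr ?mul1r ?ltr_nat ?ltr0n //.
Qed.

Let Av n : {set n.-tuple A} := [set t : n.-tuple A | ~~ infix w t]%SET.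

Lemma card_avoid_le n :
  #|patterns X (@cwindow A n) :&: Av n.*2.-1|%SET%:R <=
  expR (- ((n.*2.-1 %/ B)%:R * beta)) * (Nwords X n.*2.-1)%:R.
Proof.
set N := n.*2.-1; set k := (N %/ B)%N.
have := avoid_le Xg Xw k [::] (N %% B); rewrite -/B -/D -divn_eq.
rewrite -/(Nwords X N) -(ler_nat R) !natrM !natrX => h.
have D0 : 0 < D%:R :> R by rewrite ltr0n.
have D10 : 0 < D.-1%:R :> R by rewrite ltr0n.
have -> : expR (- (k%:R * beta)) = D.-1%:R ^+ k / D%:R ^+ k.
  by rewrite expRN expRM_natl lnK ?posrE ?divr_gt0 // expr_div_n invf_div.
rewrite mulrAC ler_pdivlMr ?exprn_gt0 // mulrC; apply: le_trans h.
rewrite ler_wpM2l ?exprn_ge0 ?ler0n // ler_nat; apply: subset_leq_card.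
apply/fintype.subsetP => t; rewrite !inE => /andP[/asboolP[x Xx <-] ->].
by rewrite andbT; apply/asboolP; exact: word_window.
Qed.

(** If the points without w had mass q > 0, the block entropy would fall below ln [Nwords] by an
    amount linear in n, by [ent_split_le]. Maximality forbids this. *)
Lemma never_null : mu never = 0%E.
Proof.
have mX := measurable_limit_closed Xcl.
pose q := fine (mu (X `&` never)).
have q0 : 0 <= q by exact: fine_ge0.
have Hq n : block_entropy X mu n <=
    1 + ln (Nwords X n.*2.-1)%:R - (n.*2.-1 %/ B)%:R * beta * q.
  set P := patterns X (@cwindow A n).
  have h := @ent_split_le R _ P (Av n.*2.-1) (@block_prob R A X mu n)
    ((n.*2.-1 %/ B)%:R * beta) (Nwords X n.*2.-1).
  apply: le_trans (h _ _ _ _ _) _.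
  - by move=> t _; exact: block_prob_ge0.
  - exact: sum_block_prob.
  - by rewrite card_patterns.
  - by rewrite mulr_ge0 // ltW.
  - exact: card_avoid_le.
  rewrite lerD2l lerN2 ler_wpM2l ?mulr_ge0 ?(ltW beta0) //.
  rewrite /q (@prob_partition _ _ _ mu _ (@cwindow A n) (P :&: Av n.*2.-1)%SET).
  - apply: ler_sum => t _; apply: fine_le; try (apply: fin_num_measure).
    + by apply: measurableI; [exact: measurableI|exact: measurable_cwindow].
    + by apply: measurableI; [exact: mX|exact: measurable_cwindow].
    apply: le_measure; rewrite ?inE.
    + by apply: measurableI; [exact: measurableI|exact: measurable_cwindow].
    + by apply: measurableI; [exact: mX|exact: measurable_cwindow].
    by move=> x [[Xx _] xt].
  - exact: measurableI.
  - by move=> t; exact: measurable_cwindow.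
  - move=> x [Xx nx]; rewrite !inE; apply/andP; split.
      by apply/asboolP; exists x.
    by apply/negP => /infix_window[j]; exact: neverP.
(* Division by n turns the deficit into a constant; the right side tends to 0 since both normalized
   logarithms tend to 2L. Rounding in the number of blocks is paid by [beta * q]. *)
have Bq n : (0 < n)%N -> B%:R^-1 * beta * q <=
    n%:R^-1 * (1 + beta * q) + (n%:R^-1 * ln (Nwords X n.*2.-1)%:R
      - n%:R^-1 * block_entropy X mu n).
  move=> n0; set a := ln _; set b := block_entropy _ _ _.
  have -> : n%:R^-1 * (1 + beta * q) + (n%:R^-1 * a - n%:R^-1 * b) =
    (1 + beta * q + a - b) / n%:R by ring.
  rewrite ler_pdivlMr ?ltr0n //.
  have nk : n%:R * B%:R^-1 <= (n.*2.-1 %/ B)%:R + 1 :> R.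
    rewrite ler_pdivrMr ?ltr0n // natr1 -natrM ler_nat.
    by apply: (@leq_trans n.*2.-1.+1); [lia|rewrite ltn_ceil].
  have := Hq n.
  have : n%:R * B%:R^-1 * (beta * q) <= ((n.*2.-1 %/ B)%:R + 1) * (beta * q).
    by rewrite ler_wpM2r // mulr_ge0 // ltW.
  rewrite mulrDl mul1r -/a -/b -!mulrA (mulrC q); lra.
have c1 : (fun n : nat => n%:R^-1 * (1 + beta * q)) @ \oo --> 0.
  by apply: (@cvg_linear_growth _ _ _ `|1 + beta * q|) => n; rewrite mulr0 subr0.
have : (fun n : nat => n%:R^-1 * (1 + beta * q) + (n%:R^-1 * ln (Nwords X n.*2.-1)%:R
    - n%:R^-1 * block_entropy X mu n)) @ \oo --> 0 + (2 * L - 2 * L).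
  by apply: cvgD c1 (cvgB (cvg_Nwords XL) (Mmax_cvg Xinv Xcl XL Xmu)).
rewrite subrr addr0 => c2.
have q00 : B%:R^-1 * beta * q <= 0.
  rewrite -(cvg_lim _ c2) //; apply: limr_ge; first by apply/cvg_ex; exists 0.
  by exists 1%N => // n n0; exact: Bq.
have {}q00 : q = 0.
  apply/eqP; rewrite eq_le q0 andbT -(pmulr_rle0 _ (_ : 0 < B%:R^-1 * beta)) //.
  by rewrite mulr_gt0 // invr_gt0 ltr0n.
rewrite -(prob_setI1 mnever mX X1) setIC.
have /fineK <- : mu (X `&` never) \is a fin_num.
  by apply: fin_num_measure; exact: measurableI.
by rewrite -/q q00.
Qed.

Let first k : set (borel Ztime A) := occ k `&` \bigcap_j ~` occ (k - (j.+1)%:Z).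

Let mfirst k : measurable (first k).
Proof.
apply: measurableI => //; apply: bigcapT_measurable => j; exact: measurableC.
Qed.

Let firstS k : mu (first (k + 1)) = mu (first k).
Proof.
have [[_ shiftmu] _] := Xmu; rewrite -[RHS]shiftmu //; congr (mu _).
have occS j : @shift_map Ztime A @^-1` occ j = occ (j + 1).
  apply/seteqP; split=> x /=; rewrite /occ /= -[shift_map x]/(translate x 1);
  by rewrite window_translate.
rewrite preimage_setI occS preimage_bigcap; congr (_ `&` _).
apply: eq_bigcapr => j _; rewrite -preimage_setC occS.
by rewrite addrAC.
Qed.

(** A first occurrence has one position, so the sets [first (k + j)] are disjoint; by invariance
    they have equal mass, and infinitely many fit into mass 1. *)
Lemma first_null k : mu (first k) = 0%E.
Proof.
have eq0 (j : nat) : mu (first (k + j%:Z)) = mu (first k).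
  elim: j => [|j IH]; first by rewrite addr0.
  by rewrite -[j.+1]addn1 PoszD addrA firstS.
have ne i j : (i < j)%N -> first (k + i%:Z) `&` first (k + j%:Z) = set0.
  move=> ij; apply/seteqP; split=> // x [[xi _] [_ /(_ (j - i).-1 I)]].
  by apply; have <- : k + i%:Z = k + j - (j - i).-1.+1%:Z by lia.
have triv : trivIset [set: nat] (fun j => first (k + j%:Z)).
  apply/trivIsetP => i j _ _; rewrite neq_ltn => /orP[/ne //|/ne <-].
  by rewrite setIC.
pose c := fine (mu (first k)).
have ck : mu (first k) = c%:E by rewrite fineK //; exact: fin_num_measure.
have c0 : 0 <= c by exact: fine_ge0.
have nc (n : nat) : n%:R * c <= 1.
  rewrite -lee_fin.
  apply: le_trans (probability_le1 mu (_ : measurable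
    (\big[setU/set0]_(i < n) first (k + (i : nat)%:Z)))); last first.
    by apply: bigsetU_measurable => i _.
  rewrite (measure_bigsetU mu (F := fun j : nat => first (k + j%:Z))) //.
  rewrite (eq_bigr (fun=> c%:E)) => [|i _]; last by rewrite -ck; exact: eq0.
  by rewrite sumEFin lee_fin sumr_const card_ord mulr_natl.
rewrite ck; congr (_%:E); apply/eqP; rewrite eq_le c0 andbT leNgt; apply/negP => c1.
have := nc (Num.truncn c^-1).+1; apply/negP; rewrite -ltNge.
by rewrite -ltr_pdivrMr // div1r truncnS_gt.
Qed.

Definition recurrent : set (borel Ztime A) :=
  \bigcap_n \bigcup_j [set x | window x (- (n + j)%N%:Z) (size w) = w].

Lemma measurable_recurrent : measurable recurrent.
Proof.
apply: bigcapT_measurable => n; apply: bigcupT_measurable => j.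
exact: measurable_window.
Qed.

Lemma recurrent_prob1 : mu recurrent = 1%E.
Proof.
suff : mu (~` recurrent) = 0%E.
  move=> h; rewrite -[recurrent]setCK probability_setC ?h ?sube0 //.
  by apply: measurableC; exact: measurable_recurrent.
apply: measure_negligible.
  by apply: measurableC; exact: measurable_recurrent.
(* A point outside [recurrent] either never shows w or has a first occurrence of it; the integers
   are enumerated as j and -j. *)
pose F j := first j%:Z `|` first (- j%:Z).
apply: (@negligibleS _ _ _ _ (never `|` \bigcup_j F j)); last first.
  apply: negligibleU; first by exists never; split=> //; exact: never_null.
  have nf k : mu.-negligible (first k).
    by exists (first k); split=> //; exact: first_null.
  by apply: negligible_bigcup => j; exact: negligibleU.
move=> x; rewrite /recurrent => /existsNP[n /not_implyP[_ nx]].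
have [nv|nnv] := pselect (never x); [by left|right].
have [k xk] : exists k, occ k x.
  apply: contrapT => /forallNP h; apply: nnv => j _; split; exact: h.
have before j : (n <= j)%N -> ~ occ (- j%:Z) x.
  by move=> nj xj; apply: nx; exists (j - n)%N => //=; rewrite subnKC.
(* No occurrence lies at or before -n, so occurrences are indexed from -n by naturals and a least
   one exists. *)
have exj : exists j : nat, `[< occ (j%:Z - n%:Z) x >].
  have [kn|kn] := leP k (- n%:Z).
    exfalso; apply: (before (absz k)); first lia.
    by have -> : - (absz k)%:Z = k by lia.
  exists (absz (k + n%:Z)); apply/asboolP.
  by have -> : (absz (k + n%:Z))%:Z - n%:Z = k by lia.
case: (ex_minnP exj) => j /asboolP xj jmin.
have fx : first (j%:Z - n%:Z) x.
  split=> // i _ xi.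
  have [ij|ij] := leqP i.+1 j.
    have : (j <= j - i.+1)%N; last by lia.
    by apply/jmin/asboolP; move: xi; congr (occ _ x); lia.
  apply: (before (n + i.+1 - j)%N); first lia.
  by move: xi; congr (occ _ x); lia.
exists (absz (j%:Z - n%:Z)) => //.
have [e|e] : j%:Z - n%:Z = absz (j%:Z - n%:Z) \/
    j%:Z - n%:Z = - (absz (j%:Z - n%:Z))%:Z by lia.
  by left; rewrite -e.
by right; rewrite -e.
Qed.

End Recurrence.
(** * Right-resolving factors *)

Section RightResolving.
Context {V A : finType} (W : set (conf Ztime V)) (Phi : V -> A) (g : nat).
Hypothesis Winv : translation_invariant W.
Hypothesis Wcl : limit_closed W.
Hypothesis Wg : gap_bounded W g.
Hypothesis Wrr : forall s a b : V, word W [:: s; a] -> word W [:: s; b] ->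
  Phi a = Phi b -> a = b.

Local Notation phi := (block_map Phi : conf Ztime V -> conf Ztime A).
Local Notation Y := (phi @` W).

Lemma word_image v : word Y v <-> exists2 u, word W u & map Phi u = v.
Proof.
split=> [[y [k [[x Wx <-] yv]]]|[u [x [k [Wx xu]]] <-]].
  exists (window x k (size v)); first exact: word_window.
  by rewrite map_window.
exists (phi x), k; split; first by exists x.
by rewrite size_map -map_window xu.
Qed.

Lemma image_translation_invariant : translation_invariant Y.
Proof.
by move=> _ j [x Wx <-]; exists (translate x j) => //; exact: Winv.
Qed.

(** Preimages of better and better approximations cluster at a preimage of the limit. *)
Lemma image_limit_closed : limit_closed Y.
Proof.
move=> y yP.
have /choice[x xP] : forall n, exists x, W x /\ agree n (phi x) y.
  by move=> n; have [_ [x Wx <-] xy] := yP n; exists x.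
have [z zP] := exists_cluster x; exists z.
  apply: Wcl => n; have [m _ xz] := zP n 0%N.
  by exists (x m) => //; case: (xP m).
apply/funext => k; have [m km xz] := zP (absz k).+1 (absz k).+1.
have [_ xy] := xP m.
by rewrite -xy //= /block_map xz.
Qed.

Lemma image_gap_bounded : gap_bounded Y g.
Proof.
move=> _ _ /word_image[u Wu <-] /word_image[v Wv <-].
have [w wg Wuwv] := Wg Wu Wv; exists (map Phi w); first by rewrite size_map.
by rewrite -!map_cat; apply/word_image; exists (u ++ w ++ v).
Qed.

Lemma resolving_words s u u' : word W (s :: u) -> word W (s :: u') ->
  map Phi u = map Phi u' -> u = u'.
Proof.
elim: u u' s => [|a u IH] [|b u'] s //= su su' [ab uu'].
have eab : a = b.
  apply: (@Wrr s) => //; first exact: (@word_prefix _ _ _ u).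
  exact: (@word_prefix _ _ _ u').
rewrite -eab in su' *; congr (_ :: _); apply: (IH _ a) => //.
  exact: (@word_suffix _ _ [:: s]) su.
exact: (@word_suffix _ _ [:: s]) su'.
Qed.

(** Among the preimages of a word, the first symbol determines the rest. Nonemptiness only matters
    for the empty word, which has one preimage. *)
Lemma card_fiber n (v : n.-tuple A) : W !=set0 ->
  (#|[set u : n.-tuple V | `[< word W u >] && (map_tuple Phi u == v)]%SET| <= #|V|)%N.
Proof.
move=> [x0 _]; case: n v => [|n] v.
  apply: (@leq_trans #|{: 0.-tuple V}|); first exact: max_card.
  by rewrite card_tuple expn0; apply/card_gt0P; exists (x0 0).
rewrite -(card_in_imset (f := @thead _ _)); first exact: max_card.
move=> u u'; rewrite !inE => /andP[/asboolP wu /eqP uv] /andP[/asboolP wu' /eqP u'v].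
case/tupleP: u wu uv => s u wu; case/tupleP: u' wu' u'v => s' u' wu' u'v uv.
rewrite !theadE => ss'; rewrite ss' in wu uv *.
apply: val_inj => /=; congr (_ :: _); apply: resolving_words wu wu' _.
by have /(congr1 val)/= [] := etrans uv (esym u'v).
Qed.

Lemma Nwords_image_le n : (Nwords Y n <= Nwords W n)%N.
Proof.
apply: leq_trans (leq_imset_card (@map_tuple n _ _ Phi) _).
apply: subset_leq_card; apply/fintype.subsetP => v; rewrite inE.
move=> /asboolP/word_image[u wu uv].
have su : size u == n by rewrite -(size_map Phi) uv size_tuple.
apply/imsetP; exists (Tuple su); first by rewrite inE; apply/asboolP.
exact: val_inj.
Qed.

Lemma Nwords_le_image n : W !=set0 -> (Nwords W n <= #|V| * Nwords Y n)%N.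
Proof.
move=> W0; rewrite {1}/Nwords ext_sum.
rewrite (partition_big (@map_tuple n _ _ Phi) (mem [set v : n.-tuple A |
   `[< word Y v >]]%SET)) /=; last first.
  by move=> u /asboolP wu; rewrite inE; apply/asboolP/word_image; exists u.
rewrite mulnC -sum_nat_const; apply: leq_sum => v _.
by rewrite sum1_card -cardsE card_fiber.
Qed.

Lemma image_growth (R : realType) (L : R) : W !=set0 ->
  has_growth W L -> has_growth Y L.
Proof.
move=> W0 [K WK]; exists (K + ln #|V|%:R) => n.
have [x0 Wx0] := W0.
have V0 : (0 < #|V|)%N by apply/card_gt0P; exists (x0 0).
have NY0 : (0 < Nwords Y n)%N by apply: Nwords_gt0; exists (phi x0), x0.
have NW0 : (0 < Nwords W n)%N by exact: Nwords_gt0.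
have h1 : ln (Nwords Y n)%:R <= ln (Nwords W n)%:R :> R.
  by rewrite ler_ln ?posrE ?ltr0n // ler_nat Nwords_image_le.
have h2 : ln (Nwords W n)%:R <= ln #|V|%:R + ln (Nwords Y n)%:R :> R.
  rewrite -lnM ?posrE ?ltr0n // -natrM ler_ln ?posrE ?ltr0n ?muln_gt0 ?V0 //.
  by rewrite ler_nat Nwords_le_image.
have h3 := ln_nat_ge0 R #|V|.
have := WK n; rewrite !ler_norml => /andP[? ?].
by apply/andP; split; lra.
Qed.

(** Synchronization with the forced symbol named. It holds vacuously for u without preimage, and is
    applied to windows of images of points of W. *)
Definition forces (u : seq A) (s : V) :=
  forall z t, word W (rcons z t) -> map Phi (rcons z t) = u -> t = s.

Lemma forces_window x (k : int) n s : W x ->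
  forces (window (phi x) (k - n%:Z) n.+1) s -> x k = s.
Proof.
move=> Wx fs; apply: (fs (window x (k - n%:Z) n)).
  by rewrite -[k in x k](subrK n%:Z) -windowS; exact: word_window.
by rewrite -[k in x k](subrK n%:Z) -windowS map_window.
Qed.

(** Once the current symbol is known, right-resolving determines the next one from its label; this
    propagates to the right only. *)
Lemma forces_step u a s s' : forces (rcons u a) s -> word W [:: s; s'] ->
  forces (rcons (rcons u a) (Phi s')) s'.
Proof.
move=> us ss' z t wzt; rewrite map_rcons => /rcons_inj[zu ts'].
case/lastP: z wzt zu => [|z c] wzt zu; first by case: u us zu.
have cs : c = s by apply: us zu; move: wzt; rewrite -cats1 => /word_prefix.
apply: Wrr ss' ts'; rewrite -cs.
by move: wzt; rewrite -!cats1 -catA => /word_suffix.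
Qed.

Lemma forces_after x p m n s : W x -> forces (window (phi x) p m.+1) s ->
  forces (window (phi x) p (m + n).+1) (x (p + (m + n)%N%:Z)).
Proof.
move=> Wx fs; elim: n => [|n IH].
  rewrite addn0; have -> // : x (p + m%:Z) = s.
  by apply: (@forces_window x _ m) => //; rewrite addrK.
rewrite addnS windowS; move: IH; rewrite windowS => /forces_step; apply.
have := word_window (p + (m + n)%N%:Z) 2 Wx.
have -> : ((m + n).+1%:Z = (m + n)%N%:Z + 1%N%:Z)%R by lia.
by rewrite addrA /window /= addr0.
Qed.

End RightResolving.

(** * Maximal measures of a right-resolving factor *)

Section MaximalMeasures.
Context {R : realType} {V A : pfinType} (W : set (conf Ztime V)) (Phi : V -> A)
  (g : nat) (L : R).
Hypothesis W0 : W !=set0.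
Hypothesis Winv : translation_invariant W.
Hypothesis Wcl : limit_closed W.
Hypothesis Wg : gap_bounded W g.
Hypothesis WL : has_growth W L.
Hypothesis Wrr : forall s a b : V, word W [:: s; a] -> word W [:: s; b] ->
  Phi a = Phi b -> a = b.

Local Notation phi := (block_map Phi : conf Ztime V -> conf Ztime A).
Local Notation Y := (phi @` W).

Let Yinv : translation_invariant Y := image_translation_invariant Winv.
Let Ycl : limit_closed Y := image_limit_closed Wcl.
Let Yg : gap_bounded Y g := image_gap_bounded Wg.
Let YL : has_growth Y L := image_growth Wrr W0 WL.

Lemma pushE (mu : probability (borel Ztime V) R) (E : set (borel Ztime A)) :
  push Phi mu E = mu (phi @^-1` E).
Proof. by []. Qed.

Lemma measurable_phi (E : set (borel Ztime A)) : measurable E ->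
  measurable (phi @^-1` E : set (borel Ztime V)).
Proof.
move=> mE; rewrite -[X in measurable X]setTI.
exact: (@block_map_measurable Ztime V A Phi).
Qed.

Section Push.
Variables (mu : probability (borel Ztime V) R).
Hypothesis W1 : mu W = 1%E.

Lemma push_image1 : push Phi mu Y = 1%E.
Proof.
apply/eqP; rewrite eq_le; apply/andP; split.
  by apply: probability_le1; exact: measurable_limit_closed.
rewrite pushE -W1; apply: le_measure; rewrite ?inE.
- exact: measurable_limit_closed.
- by apply: measurable_phi; exact: measurable_limit_closed.
- by move=> x Wx; exists x.
Qed.

Lemma block_prob_push n (v : n.*2.-1.-tuple A) :
  block_prob Y (push Phi mu) v =
  \sum_(u in patterns W (@cwindow V n) | map_tuple Phi u == v)
    block_prob W mu u.
Proof.
have mW := measurable_limit_closed Wcl.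
have mY := measurable_limit_closed Ycl.
have mv : measurable (Y `&` @cwindow A n @^-1` [set v] : set (borel Ztime A)).
  by apply: measurableI => //; exact: measurable_cwindow.
rewrite /block_prob pushE -(prob_setI1 (measurable_phi mv) mW W1).
rewrite (@prob_partition _ _ _ mu _ (@cwindow V n)
  [set u in patterns W (@cwindow V n) | map_tuple Phi u == v]%SET); last 3 first.
- by apply: measurableI => //; exact: measurable_phi.
- by move=> u; exact: measurable_cwindow.
- move=> x [[_ /= xv] Wx]; rewrite inE; apply/andP; split.
    by apply/patternsP; exists x.
  by apply/eqP/val_inj; rewrite /= map_window -xv.
apply: eq_big => [u|u]; rewrite inE // => /andP[_ /eqP uv].
congr (fine (mu _)); apply/seteqP; split=> x [].
  by move=> [_ Wx] xu; split.
move=> Wx /= xu; split=> //; split=> //; split; first by exists x.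
by rewrite /= -uv -xu; apply: val_inj; rewrite /= map_window.
Qed.

(** Merging the windows over one image window can only lower entropy, and by at most ln #|V| since
    fibres have at most #|V| windows. *)
Lemma block_entropy_push n :
  block_entropy Y (push Phi mu) n <= block_entropy W mu n <=
  block_entropy Y (push Phi mu) n + ln #|V|%:R.
Proof.
set PW := patterns W (@cwindow V n); set PY := patterns Y (@cwindow A n).
have PWY u : u \in PW -> map_tuple Phi u \in PY.
  move=> /patternsP[x Wx <-]; apply/patternsP; exists (phi x); first by exists x.
  by apply: val_inj; rewrite /= map_window.
have -> : block_entropy W mu n = \sum_(v in PY)
    \sum_(u in PW | map_tuple Phi u == v)
      - (block_prob W mu u * ln (block_prob W mu u)).
  by rewrite /block_entropy (partition_big (map_tuple Phi) (mem PY)).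
have p0 v (u : n.*2.-1.-tuple V) : (u \in PW) && (map_tuple Phi u == v) ->
    0 <= block_prob W mu u by move=> _; exact: block_prob_ge0.
apply/andP; split.
  apply: ler_sum => v _; rewrite block_prob_push; apply: ent_sum_ge; exact: p0.
have card_le v : \sum_(u in PW | map_tuple Phi u == v) 1 <= #|V|%:R :> R.
  rewrite sumr_const ler_nat.
  apply: leq_trans (card_fiber Wrr v W0); apply: subset_leq_card.
  apply/fintype.subsetP => u /andP[/patternsP[x Wx xu] uv].
  rewrite inE uv andbT -xu; apply/asboolP; exact: word_window.
have -> : ln #|V|%:R = \sum_(v in PY) block_prob Y (push Phi mu) v * ln #|V|%:R :> R.
  by rewrite -mulr_suml sum_block_prob ?mul1r //; exact: push_image1.
rewrite -big_split /=.
by apply: ler_sum => v _; rewrite block_prob_push; exact: ent_sum_le (p0 v) (card_le v).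
Qed.

End Push.

(** The constant ln #|V| vanishes after division by n, and Y has the same growth rate as W. *)
Lemma push_Mmax mu : Mmax R W mu -> Mmax R Y (push Phi mu).
Proof.
move=> Wmu; have [[W1 shiftmu] _] := Wmu.
apply: (@Mmax_of_lower_bound R A Y L Yinv Ycl YL _
  (fun n => block_entropy W mu n - ln #|V|%:R)).
- split; first exact: push_image1.
  move=> E mE; rewrite !pushE -[RHS]shiftmu //; exact: measurable_phi.
- by move=> n; have /andP[_] := block_entropy_push W1 n; rewrite lerBlDr.
- have c0 : (fun n : nat => n%:R^-1 * ln (#|V|%:R : R)) @ \oo --> 0.
    apply: (@cvg_linear_growth _ _ _ `|ln #|V|%:R|) => n.
    by rewrite mulr0 subr0.
  rewrite -[2 * L]subr0; under eq_fun do rewrite mulrBr.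
  exact: cvgB (Mmax_cvg Winv Wcl WL Wmu) c0.
Qed.

Variables (w : seq A) (b : A) (s0 : V).
Hypothesis Yw : word Y (rcons w b).
Hypothesis sync : forces W Phi (rcons w b) s0.

Definition good : set (borel Ztime A) := Y `&` recurrent (rcons w b).

Lemma measurable_good : measurable good.
Proof.
apply: measurableI; first exact: measurable_limit_closed.
exact: measurable_recurrent.
Qed.

Lemma good_prob1 nu : Mmax R Y nu -> nu good = 1%E.
Proof.
move=> Ynu; have [[Y1 _] _] := Ynu.
rewrite /good setIC (prob_setI1 _ _ Y1).
- exact: (recurrent_prob1 Yinv Ycl Yg YL Ynu Yw).
- exact: measurable_recurrent.
- exact: measurable_limit_closed.
Qed.

(** Some synchronizing word ends before k, and [forces_after] carries its forced symbol on to k. *)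
Lemma good_forces x (k : int) : W x -> good (phi x) ->
  exists n, forces W Phi (window (phi x) (k - n%:Z) n.+1) (x k).
Proof.
move=> Wx [_ /(_ (absz k + (size w).+1)%N I)[j _ /= xw]].
set p := - _ in xw; rewrite size_rcons in xw.
have pk : p + (size w)%:Z <= k by rewrite /p; lia.
exists (absz (k - p)); have -> : k - (absz (k - p))%:Z = p by lia.
have fw : forces W Phi (window (phi x) p (size w).+1) s0 by rewrite xw.
have := forces_after Wrr (n := (absz (k - p)%R - size w)%N) Wx fw.
have -> : (size w + (absz (k - p) - size w) = absz (k - p))%N by lia.
by have -> : p + (absz (k - p))%:Z = k by lia.
Qed.

Lemma good_inj x x' : W x -> W x' -> phi x = phi x' -> good (phi x) -> x = x'.
Proof.
move=> Wx Wx' xx' gx; apply/funext => k.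
have [n fk] := good_forces k Wx gx.
by rewrite xx' in fk; rewrite (forces_window Wx' fk).
Qed.

Lemma good_shift y : good y -> good (shift_map y).
Proof.
move=> [Yy ry]; split; first exact: (Yinv 1 Yy).
move=> n _; have [j _ /= yj] := ry n I; exists j.+1 => //=.
rewrite -[shift_map y]/(translate y 1) window_translate -[RHS]yj.
by congr (window y _ _); lia.
Qed.

(** Chosen preimages on [good], a fixed point elsewhere. Although f comes from choice it is
    measurable, because on [good] each coordinate is decided by a finite window. *)
Lemma exists_section : exists2 f : borel Ztime A -> borel Ztime V,
  measurable_fun setT f & forall y, W (f y) /\ (good y -> phi (f y) = y).
Proof.
have [x0 Wx0] := W0.
have /choice[f fP] : forall y, exists x,
    (good y -> W x /\ phi x = y) /\ (~ good y -> x = x0).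
  move=> y; have [gy|ngy] := pselect (good y); last by exists x0; split.
  by have [[x Wx xy] _] := gy; exists x; split.
have fW y : good y -> W (f y) by move=> gy; have [/(_ gy)[]] := fP y.
have fphi y : good y -> phi (f y) = y by move=> gy; have [/(_ gy)[]] := fP y.
have f0 y : ~ good y -> f y = x0 by case: (fP y).
exists f; last first.
  move=> y; split; last exact: fphi.
  by have [/fW|/f0 ->] := pselect (good y).
apply: measurable_fun_conf => k a.
(* On [good], coordinate k of [f y] is a exactly when, for some n, the window of y from k - n to k
   forces a. *)
pose F n := \bigcup_(u in [set u : n.+1.-tuple A | forces W Phi u a])
  [set y : borel Ztime A | window y (k - n%:Z) (size u) = u].
have mF n : measurable (F n).
  apply: fin_bigcup_measurable; first exact: finite_finset.
  by move=> u _; exact: measurable_window.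
rewrite [X in measurable X](_ : _ = (good `&` \bigcup_n F n) `|`
    (~` good `&` [set _ | x0 k = a])); last first.
  apply/seteqP; split=> y /=.
    move=> fya; have [gy|ngy] := pselect (good y); [left|right].
      split=> //; have gfy : good (phi (f y)) by rewrite fphi.
      have [n] := good_forces k (fW _ gy) gfy; rewrite fphi // fya => fn.
      exists n => //; have sy : size (window y (k - n%:Z) n.+1) == n.+1.
        by rewrite size_window.
      by exists (Tuple sy); [exact: fn|rewrite /mkset size_tuple].
    by split=> //; rewrite -fya f0.
  move=> [[gy [n _ [u /= fu]]]|[/f0 -> //]]; rewrite size_tuple => yu.
  by apply: (@forces_window _ _ W Phi (f y) k n); [exact: fW|rewrite fphi // yu].
apply: measurableU.
  by apply: measurableI; [exact: measurable_good|exact: bigcupT_measurable].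
apply: measurableI; first by apply: measurableC; exact: measurable_good.
have [x0a|x0a] := pselect (x0 k = a).
  by rewrite [X in measurable X](_ : _ = setT) //; apply/seteqP; split.
by rewrite [X in measurable X](_ : _ = set0) //; apply/seteqP; split.
Qed.

Lemma Mmax_one_to_one : one_to_one_correspondence (Mmax R W) (Mmax R Y).
Proof.
have [f mf fP] := exists_section.
have mfE (E : set (borel Ztime V)) : measurable E -> measurable (f @^-1` E).
  by move=> mE; rewrite -[X in measurable X]setTI; exact: mf.
have mW := measurable_limit_closed Wcl.
have ff x : W x -> good (phi x) -> f (phi x) = x.
  move=> Wx gx; have [Wfx fx] := fP (phi x).
  by apply: good_inj => //; [exact: fx|rewrite fx].
exists (push Phi); split.
- split=> [mu|mu mu' _ _ eqmu E mE]; first exact: push_Mmax.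
  by rewrite !pushE eqmu //; exact: measurable_phi.
(* Injectivity: on a set of full mass f undoes the covering map, so mu can be read off from its
   push-forward. *)
- have lift mu E : Mmax R W mu -> measurable E ->
      mu E = push Phi mu (f @^-1` E).
    move=> Wmu mE; have [[W1 _] _] := Wmu.
    have mgood := measurable_phi measurable_good.
    have g1 : mu (W `&` phi @^-1` good) = 1%E.
      rewrite setIC (prob_setI1 mgood mW W1).
      exact: good_prob1 (push_Mmax Wmu).
    have mWg : measurable (W `&` phi @^-1` good : set (borel Ztime V)).
      exact: measurableI.
    rewrite pushE -(prob_setI1 mE mWg g1).
    rewrite -[RHS](prob_setI1 (measurable_phi (mfE _ mE)) mWg g1).
    congr (mu _); apply/seteqP; split=> x [xE [Wx gx]]; split=> //.
      by rewrite /preimage /= ff.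
    by move: xE; rewrite /preimage /= ff.
  move=> mu mu' Wmu Wmu' eqmu E mE.
  by rewrite !lift // eqmu //; exact: mfE.
- move=> nu Ynu; have [[Y1 shiftnu] _] := Ynu.
  have mgood := measurable_good; have nugood := good_prob1 Ynu.
  pose F : {mfun borel Ztime A >-> borel Ztime V} :=
    HB.pack f (isMeasurableFun.Build _ _ _ _ f mf).
  (* Surjectivity: the preimage of nu is its push-forward along the section. *)
  pose mu : probability (borel Ztime V) R := distribution nu F.
  have muE E : mu E = nu (f @^-1` E) by [].
  have mu1 : mu W = 1%E.
    rewrite muE [X in nu X](_ : _ = setT); first exact: probability_setT.
    by apply/seteqP; split=> // y _; have [] := fP y.
  have pushmu : Defs.eq_measure (push Phi mu) nu.
    move=> E mE; rewrite pushE muE -(prob_setI1 (mfE _ (measurable_phi mE)) mgood nugood).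
    rewrite -[RHS](prob_setI1 mE mgood nugood); congr (nu _).
    apply/seteqP; split=> y [yE gy]; split=> //; have [_ /(_ gy) fy] := fP y.
      by move: yE; rewrite /preimage /= fy.
    by rewrite /preimage /= fy.
  exists mu => //.
  apply: (@Mmax_of_lower_bound R V W L Winv Wcl WL _ (block_entropy Y nu)).
  + split=> // E mE; rewrite !muE -[RHS]shiftnu; last exact: mfE.
    rewrite -(prob_setI1 (mfE _ (measurable_shift mE)) mgood nugood).
    rewrite -[RHS](prob_setI1 (measurable_shift (mfE _ mE)) mgood nugood).
    (* The section was chosen pointwise, yet it commutes with the shift on [good]: both sides are
       preimages of the same good point, and those are unique. *)
    have fshift y : good y -> f (shift_map y) = shift_map (f y).
      move=> gy; have [Wf fphi] := fP y; have [Wfs fphis] := fP (shift_map y).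
      apply: good_inj => //.
      * exact: (Winv 1 Wf).
      * rewrite fphis; last exact: good_shift.
        by rewrite -[in LHS]fphi.
      * by rewrite fphis; exact: good_shift.
    congr (nu _); apply/seteqP; split=> y [yE gy]; split=> //.
      by rewrite /preimage /= fshift.
    by move: yE; rewrite /preimage /= fshift.
  (* The block entropies of mu dominate those of its image nu, which already have the maximal
     rate. *)
  + move=> n; have /andP[+ _] := block_entropy_push mu1 n; apply: le_trans.
    rewrite /block_entropy /block_prob le_eqVlt; apply/predU1P; left.
    apply: eq_bigr => t _; rewrite pushmu //.
    apply: measurableI; last exact: measurable_cwindow.
    exact: measurable_limit_closed.
  + exact: Mmax_cvg.
Qed.

End MaximalMeasures.
(** * Markov chains *)

Section MarkovChain.
Context {A : finType} (S : {set A}) (T : rel A).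
Local Notation X := (@markov_chain Ztime A S T).

Lemma markov_translation_invariant : translation_invariant X.
Proof.
move=> x j Xx k; have [xS xT] := Xx (k + j); split=> //.
by rewrite /translate /= addrAC.
Qed.

Lemma markov_limit_closed : limit_closed X.
Proof.
move=> x xP k; have [y Xy yx] := xP (absz k).+2.
have [yS yT] := Xy k; have := yx k; have := yx (k + 1).
rewrite /= => h1 h0; rewrite -h0; last by lia.
by rewrite -h1; [split|lia].
Qed.

(** Markov property: the past of one point and the future of another are spliced at coordinate 0,
    where both carry a. *)
Lemma markov_glue u a v : word X (u ++ [:: a]) -> word X (a :: v) ->
  word X (u ++ a :: v).
Proof.
move=> /(word_at (- (size u)%:Z) markov_translation_invariant)[x Xx].
rewrite size_cat window_add => /eqP; rewrite eqseq_cat ?size_window //.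
move=> /andP[/eqP xu]; rewrite window1 addNr => /eqP[xa].
move=> /(word_at 0 markov_translation_invariant)[x' Xx'].
rewrite /= -add1n window_add window1 => -[x'a x'v].
pose z : conf Ztime A := fun k => if (k < 0)%R then x k else x' k.
have Xz : X z.
  move=> k; rewrite /z /=; have [k0|k0] := ltP k 0; last first.
    by rewrite ltNge (le_trans k0) ?lerDl //; exact: Xx'.
  have [xS xT] := Xx k; split=> //; case: ltP => // k1.
  have k10 : k + 1 = 0 by lia.
  by move: xT; rewrite /= k10 xa x'a.
exists z, (- (size u)%:Z); split=> //; rewrite size_cat window_add addNr.
congr (_ ++ _).
  rewrite -[RHS]xu; apply/window_eqP => j ju; rewrite /z.
  by have -> : - (size u)%:Z + j%:Z < 0 by lia.
rewrite /= -add1n window_add window1 /= /z ltxx x'a; congr (_ :: _).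
rewrite -[RHS]x'v; apply/window_eqP => j _; rewrite /z.
by have -> : (0 + 1%:Z + j%:Z < 0) = false by lia.
Qed.

(** By gluing, a connecting word depends only on the last symbol of u and the first of v; there are
    finitely many such pairs, so a maximum exists. *)
Lemma irreducible_gap_bounded : irreducible X -> exists g, gap_bounded X g.
Proof.
move=> Xirr.
have /choice[w wP] : forall p : A * A, exists w : seq A,
    word X [:: p.1] -> word X [:: p.2] -> word X ([:: p.1] ++ w ++ [:: p.2]).
  move=> [a b]; have [wa|] := pselect (word X [:: a]); last by exists [::].
  have [wb|] := pselect (word X [:: b]); last by exists [::].
  by have [w ?] := Xirr _ _ wa wb; exists w.
exists (\max_p size (w p))%N => u v wu wv.
case/lastP: u wu => [|u a] wu; first by exists [::].
case: v wv => [|b v] wv; first by exists [::] => //=; rewrite cats0.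
exists (w (a, b)); first exact: leq_bigmax.
have wa : word X [:: a] by move: wu; rewrite -cats1 => /word_suffix.
have wb : word X [:: b] by exact: (@word_prefix _ _ [:: b] v).
have wab := wP (a, b) wa wb.
rewrite -cats1 -catA /=; apply: markov_glue; first by rewrite cats1.
have := @markov_glue (a :: w (a, b)) b v; rewrite /= -!cat_cons; apply=> //.
Qed.

End MarkovChain.

(** A round that changes the set removes an element, so at most #|D| rounds are effective. *)
Lemma iter_fixpoint (T : finType) (f : {set T} -> {set T}) (D : {set T}) :
  (forall E, f E \subset E) -> f (iter #|D| f D) = iter #|D| f D.
Proof.
move=> fsub.
have step n : f (iter n f D) = iter n f D \/ (#|iter n.+1 f D| + n.+1 <= #|D|)%N.
  elim: n => [|n [IH|IH]].
  - have := fsub D; rewrite finset.subEproper => /predU1P[->|/proper_card]; first by left.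
    by right; rewrite addn1.
  - by left; rewrite /= IH.
  have := fsub (iter n.+1 f D); rewrite finset.subEproper => /predU1P[e|/proper_card h].
    by left.
  right; rewrite addnS; apply: leq_trans IH.
  by rewrite ltn_add2r.
by case: (step #|D|) => // h; exfalso; lia.
Qed.

(** * The one-sided chain *)

Section OneSided.
Context {R : realType} {A : finType} (S : {set A}) (T : rel A).
Hypothesis predS : forall a, a \in S -> exists2 b, b \in S & T b a.
Local Notation X := (@markov_chain Ztime A S T).
Local Notation Xplus := (@markov_chain Ntime A S T).

Lemma markov_extend x : Xplus x -> exists2 z, X z & forall k : nat, z k%:Z = x k.
Proof.
move=> Xx.
have /choice[p pP] : forall a, exists b, a \in S -> b \in S /\ T b a.
  move=> a; have [aS|] := boolP (a \in S); last by exists a.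
  by have [b bS Tba] := predS aS; exists b.
pose b j := iter j p (x 0%N).
have bS j : b j \in S.
  by elim: j => [|j IH]; [case: (Xx 0%N)|rewrite /b /=; case: (pP _ IH)].
(* [Negz n] is -(n+1), reached by n + 1 backward choices from [x 0]. *)
pose z : conf Ztime A :=
  fun k : int => match k with Posz n => x n | Negz n => b n.+1 end.
exists z => // -[] n /=.
  by rewrite addn1; exact: Xx.
split; first exact: (bS n.+1).
case: n => [|n].
  have -> : Negz 0 + 1 = 0%:Z by lia.
  by case: (pP _ (bS 0%N)).
have -> : Negz n.+1 + 1 = Negz n by lia.
by case: (pP _ (bS n.+1)).
Qed.

(** One-sided points extend to the left, so initial words are the words of the two-sided chain. The
    n letters here, against 2n - 1 in a two-sided cylinder, give the factor 2 in (ii). *)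
Lemma top_entropy_onesided (L : R) : has_growth X L -> top_entropy R Xplus = L.
Proof.
move=> [K XK]; apply: cvg_lim => //.
apply: (@cvg_linear_growth _ _ _ K) => n.
rewrite (card_cylinders Xplus (@initial_word_agree A n)).
have -> : #|patterns Xplus (@initial_word A n)| = Nwords X n; last exact: XK.
rewrite /Nwords /num_ext; congr #|pred_of_set _|.
have zx_window (x : conf Ntime A) (z : conf Ztime A) :
    (forall k : nat, z k%:Z = x k) -> window z 0 n = initial_word n x.
  move=> zx; apply: (@eq_from_nth _ (x 0%N)) => [|j];
    rewrite size_window ?size_tuple // => jn.
  rewrite nth_window // add0r zx -[j]/(nat_of_ord (Ordinal jn)) -tnth_nth.
  by rewrite tnth_mktuple.
apply/setP => t; rewrite inE; apply/patternsP/asboolP => [[x Xx <-]|].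
  have [z Xz zx] := markov_extend Xx.
  by rewrite -(zx_window x z zx); exact: word_window.
move=> /(word_at 0 (@markov_translation_invariant A S T))[z Xz zt].
exists (fun k : nat => z k%:Z).
  by move=> k; have := Xz k%:Z; rewrite /= -PoszD addn1.
by apply: val_inj; rewrite -[LHS](zx_window _ z) // -[RHS]zt /= size_tuple.
Qed.

End OneSided.
(** * The covering spaces *)

Section CoveringSpace.
Context {R : realType} (N : cnn R) (l : layer).
Local Notation K := (cnn_nbhd N).
Local Notation r := (rpred K).+1.

Lemma rpred_gt0 : (0 < rpred K)%N.
Proof. by case: N => [[d|]] /= *; rewrite /rpred /= ?addn_gt0; lia. Qed.

Lemma nth_init_tuple n (v : n.+1.-tuple bool) j : (j < n)%N ->
  nth true (init_tuple v) j = nth true v j.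
Proof.
by move=> jn; rewrite -[j in LHS]/(nat_of_ord (Ordinal jn)) -tnth_nth
  tnth_mktuple (tnth_nth true).
Qed.

Lemma nth_tail_tuple n (v : n.+1.-tuple bool) j : (j < n)%N ->
  nth true (tail_tuple v) j = nth true v j.+1.
Proof.
by move=> jn; rewrite -[j in LHS]/(nat_of_ord (Ordinal jn)) -tnth_nth
  tnth_mktuple (tnth_nth true).
Qed.

Lemma layer_row_first n (p : n.+1.-tuple bool * n.+1.-tuple bool) :
  layer_row l (first_cols p) = init_tuple (layer_row l p).
Proof. by case: l. Qed.

Lemma layer_row_last n (p : n.+1.-tuple bool * n.+1.-tuple bool) :
  layer_row l (last_cols p) = tail_tuple (layer_row l p).
Proof. by case: l. Qed.

Lemma stepP (S : {set vertex N}) alpha p :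
  reflect (exists2 q, [/\ q \in basic_set N, first_cols q \in S
                        & layer_row l q = alpha] & p = last_cols q)
          (p \in step l S alpha).
Proof.
apply: (iffP imsetP) => [[q]|[q [qB qS qa] ->]].
  by rewrite inE => /andP[qB /andP[qS /eqP qa]] ->; exists q.
by exists q => //; rewrite inE qB qS qa eqxx.
Qed.

Lemma step_row S alpha p : p \in step (N := N) l S alpha ->
  layer_row l p = tail_tuple alpha.
Proof. by move=> /stepP[q [_ _ <-] ->]; rewrite layer_row_last. Qed.

Lemma arrowP (S S' : {set vertex N}) :
  reflect (exists2 alpha, S' = step l S alpha & S' != finset.set0)
          (arrow l S S').
Proof.
apply: (iffP andP) => [[S0 /existsP[alpha /eqP Sa]]|[alpha Sa S0]].
  by exists alpha.
by split=> //; apply/existsP; exists alpha; apply/eqP.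
Qed.

Lemma arrow_row (S S' : {set vertex N}) p q : arrow l S S' ->
  p \in S' -> q \in S' -> layer_row l p = layer_row l q.
Proof. by move=> /arrowP[alpha -> _] /step_row -> /step_row ->. Qed.

Lemma cover_symbolE (S S' : {set vertex N}) p : arrow l S S' -> p \in S' ->
  cover_symbol N l S' = last true (layer_row l p).
Proof.
move=> SS' pS'; rewrite /cover_symbol; case: pickP => [q qS'|/(_ p)].
  by rewrite (arrow_row SS' pS' qS').
by rewrite pS'.
Qed.

(** Arrows are labelled by whole rows of width r, while the covering map shows one symbol. The other
    r - 1 symbols of the label are the common row of the source, so one symbol suffices. *)
Lemma W_resolving (s a b : {set vertex N}) :
  word (W N l) [:: s; a] -> word (W N l) [:: s; b] ->
  cover_symbol N l a = cover_symbol N l b -> a = b.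
Proof.
(* Points are two-sided, so s also has an incoming arrow; this guarantees that all its patterns
   share their row. *)
move=> [x [k [Wx]]]; rewrite /= (windowS x k 1) window1 /= => -[xs xa].
move=> [x' [k' [Wx']]]; rewrite /= (windowS x' k' 1) window1 /= => -[x's x'b].
have [_ ss] := Wx (k - 1); rewrite /= subrK xs in ss.
have [_ sa] := Wx k; rewrite /= xs xa in sa.
have [_ sb] := Wx' k'; rewrite /= x's x'b in sb.
have /arrowP[alpha aE /finset.set0Pn[p pa]] := sa.
have /arrowP[beta bE /finset.set0Pn[q qb]] := sb.
rewrite (cover_symbolE sa pa) (cover_symbolE sb qb).
rewrite aE in pa; rewrite bE in qb.
rewrite (step_row pa) (step_row qb) => e.
rewrite aE bE; congr (step _ _ _).
have /stepP[p' [_ p's p'a] _] := pa; have /stepP[q' [_ q's q'b] _] := qb.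
have ini : init_tuple alpha = init_tuple beta.
  by rewrite -p'a -q'b -!layer_row_first; exact: arrow_row ss _ _.
have r0 := rpred_gt0; apply: val_inj.
apply: (@eq_from_nth _ true); rewrite ?size_tuple // => j jr.
have [jl|jl] := ltnP j (rpred K).
  by rewrite -!nth_init_tuple // ini.
have -> : j = (rpred K).-1.+1 by lia.
rewrite -!nth_tail_tuple ?prednK //.
by move: e; rewrite -!nth_last !size_tuple.
Qed.

Lemma cover_alphabet_stable :
  prune l (cover_alphabet N l) = cover_alphabet N l.
Proof.
apply: iter_fixpoint => E; apply/fintype.subsetP => S.
by rewrite inE => /andP[].
Qed.

Lemma cover_predecessor a : a \in cover_alphabet N l ->
  exists2 b, b \in cover_alphabet N l & arrow l b a.
Proof.
rewrite -{1}cover_alphabet_stable inE => /and3P[_ /existsP[b /andP[bS ba]] _].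
by exists b.
Qed.

(** Vertices on a bi-infinite path support each other and survive every round of deletion. *)
Lemma path_in_W (x : conf Ztime {set vertex N}) :
  (forall k : int, x k \in reachable N l /\ arrow l (x k) (x (k + 1))) ->
  W N l x.
Proof.
move=> xP; suff h n k : x k \in iter n (prune l) (reachable N l).
  by move=> k; split; [exact: h|case: (xP k)].
elim: n k => [|n IH] k; first by case: (xP k).
rewrite /= inE IH /=; apply/andP; split; apply/existsP.
  by exists (x (k - 1)); rewrite IH /=; have [_] := xP (k - 1); rewrite subrK.
by exists (x (k + 1)); rewrite IH /=; case: (xP k).
Qed.

(** The offset makes column k + 1 the last one, so that [first_cols] ends at column k, the symbol to
    be shown at time k. *)
Let top_pattern (ys : conf Ztime bool * conf Ztime bool) (k : int) :
    r.-tuple bool * r.-tuple bool :=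
  (local_row N ys.1 (k + 1 - (right_radius K)%:Z),
   local_row N ys.2 (k + 1 - (right_radius K)%:Z)).

Lemma nth_local_row y i j : (j < r)%N ->
  nth true (local_row N y i) j = y (i + j%:Z - (left_radius K)%:Z).
Proof.
by move=> jr; rewrite -[j in LHS]/(nat_of_ord (Ordinal jr)) -tnth_nth
  tnth_mktuple.
Qed.

Lemma local_row_next y i :
  tail_tuple (local_row N y i) = init_tuple (local_row N y (i + 1)).
Proof.
apply: eq_from_tnth => j; rewrite !(tnth_nth true).
rewrite nth_tail_tuple // nth_init_tuple //.
rewrite !nth_local_row ?ltnS ?(ltnW (ltn_ord j)) //.
by congr (y _); lia.
Qed.

Definition sol_layer (ys : conf Ztime bool * conf Ztime bool) :=
  if l is layer2 then ys.1 else ys.2.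

Lemma layer_spaceE : layer_space N l = sol_layer @` solution_space N.
Proof. by rewrite /layer_space /sol_layer; case: l. Qed.

Lemma layer_space_sub_image ys : solution_space N ys ->
  exists2 x, W N l x & block_map (cover_symbol N l) x = sol_layer ys.
Proof.
move=> ysP.
pose Q := top_pattern ys; pose v k := first_cols (Q k).
have QB k : Q k \in basic_set N by exact: ysP.
have Qv k : last_cols (Q k) = v (k + 1).
  rewrite /last_cols /v /first_cols /Q /top_pattern /= !local_row_next.
  by congr (init_tuple (local_row _ _ _), init_tuple (local_row _ _ _)); lia.
(* The subset construction started at time -n from the true vertex and fed with the labels of the
   solution; it always contains the true vertex and so never becomes empty. *)
pose S n := fix S (j : nat) : {set vertex N} :=
  if j is j'.+1 then step l (S j') (layer_row l (Q (- n%:Z + j'%:Z)))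
  else [set v (- n%:Z)]%SET.
have vS n j : v (- n%:Z + j%:Z) \in S n j.
  elim: j => [|j IH]; first by rewrite addr0 finset.in_set1.
  apply/stepP; exists (Q (- n%:Z + j%:Z)) => //.
  by rewrite Qv; congr v; lia.
have Sarrow n j : arrow l (S n j) (S n j.+1).
  apply/arrowP; exists (layer_row l (Q (- n%:Z + j%:Z))) => //.
  by apply/finset.set0Pn; exists (v (- n%:Z + j.+1%:Z)).
have Sreach n j : S n j \in reachable N l.
  rewrite inE; apply/existsP; exists (v (- n%:Z)).
  by elim: j => [|j IH] //; apply: connect_trans IH (connect1 (Sarrow n j)).
(* Meaningful for k >= -n only; in a cluster point as n grows, each coordinate comes from the
   meaningful range. *)
pose X n : conf Ztime {set vertex N} := fun k : int => S n (absz (k + n%:Z)).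
have [x xP] := exists_cluster X.
have xloc (k : int) : exists n j, [/\ x k = S n j, x (k + 1) = S n j.+1
    & k = - n%:Z + j%:Z].
  have [n kn Xx] := xP (absz k).+2 (absz k).+1.
  exists n, (absz (k + n%:Z)); split; last by lia.
    by rewrite -Xx //=; lia.
  have -> : (absz (k + n%:Z)).+1 = absz (k + 1 + n%:Z) by lia.
  by rewrite -Xx //=; lia.
exists x.
  apply: path_in_W => k; have [n [j [-> -> _]]] := xloc k.
  by split.
apply/funext => k; rewrite /block_map.
have [n [j [xk xk1 kE]]] := xloc (k - 1); rewrite subrK in xk1.
have vk : v k \in S n j.+1.
  by have -> : k = - n%:Z + j.+1%:Z by lia.
rewrite xk1 (cover_symbolE (Sarrow n j) vk) /v layer_row_first.
have r0 := rpred_gt0; rewrite -nth_last size_tuple nth_init_tuple ?prednK //.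
have -> : layer_row l (Q k) =
    local_row N (sol_layer ys) (k + 1 - (right_radius K)%:Z).
  by rewrite /sol_layer /Q /top_pattern; case: l.
rewrite nth_local_row; last by rewrite ltnS leq_pred.
by congr (sol_layer ys _); move: r0; rewrite /rpred; lia.
Qed.

Lemma solution_translate ys j : solution_space N ys ->
  solution_space N (translate ys.1 j, translate ys.2 j).
Proof.
move=> ysP i; have e y : local_row N (translate y j) i = local_row N y (i + j).
  apply: eq_from_tnth => k; rewrite !tnth_mktuple /translate; congr (y _); lia.
by rewrite /= !e; exact: ysP.
Qed.

(** Overlapping rows assemble to a sequence; each symbol is read where it is the first entry, hence
    the shift by [left_radius K]. *)
Lemma rows_of_sequence (t : int -> r.-tuple bool) :
  (forall k, tail_tuple (t k) = init_tuple (t (k + 1))) ->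
  exists y, forall k, local_row N y k = t k.
Proof.
move=> tP; exists (fun k : int => nth true (t (k + (left_radius K)%:Z)) 0).
have tnxt k j : (j < rpred K)%N -> nth true (t k) j.+1 = nth true (t (k + 1)) j.
  by move=> jr; rewrite -nth_tail_tuple // tP nth_init_tuple.
move=> k; apply: val_inj; apply: (@eq_from_nth _ true); rewrite ?size_tuple //.
move=> j jr; rewrite nth_local_row // subrK.
elim: j k jr => [|j IH] k jr; first by rewrite addr0.
rewrite tnxt // -IH; last exact: ltnW.
by congr (nth _ (t _) _); lia.
Qed.

Lemma image_sub_layer_space x : W N l x ->
  layer_space N l (block_map (cover_symbol N l) x).
Proof.
move=> Wx.
have /choice[al alP] : forall k : int, exists alpha,
    x (k + 1) = step l (x k) alpha /\ x (k + 1) != finset.set0.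
  by move=> k; have [_ /arrowP[alpha ? ?]] := Wx k; exists alpha.
pose good_at (Q : int -> r.-tuple bool * r.-tuple bool) (k : int) :=
  [/\ Q k \in basic_set N, layer_row l (Q k) = al k
    & last_cols (Q k) = first_cols (Q (k + 1))].
(* Paths are lifted backwards: every element of a step has a predecessor in the source set, whereas
   an element of the source may have no successor with the given label. *)
have back m k p : p \in x (k + m%:Z) -> exists Q : nat -> r.-tuple bool * r.-tuple bool,
    forall j, (j < m)%N -> [/\ Q j \in basic_set N, layer_row l (Q j) = al (k + j%:Z),
      first_cols (Q j) \in x (k + j%:Z) &
      last_cols (Q j) = if (j.+1 < m)%N then first_cols (Q j.+1) else p].
  elim: m p => [|m IH] p.
    by exists (fun=> (local_row N (fun=> true) 0, local_row N (fun=> true) 0)).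
  have [xs _] := alP (k + m%:Z).
  have -> : k + m.+1%:Z = k + m%:Z + 1 by lia.
  rewrite xs => /stepP[q [qB qx qa] pq].
  have [Q QP] := IH _ qx.
  exists (fun j => if (j < m)%N then Q j else q) => j; rewrite ltnS => jm.
  case: ltnP => [jm'|mj].
    have [QB Qa Qx Ql] := QP j jm'; split=> //.
    by rewrite ltnS jm' Ql; case: ifP.
  have -> : j = m by lia.
  by split=> //; rewrite ltnn.
(* A lift of length 2n ending at time n covers the times from -n on; a cluster point over n is a
   lift for all times. *)
have /choice[Z ZP] : forall n : nat, exists Z : int -> r.-tuple bool * r.-tuple bool,
    forall k : int, (- n%:Z <= k)%R -> (k + 1 < n%:Z)%R -> good_at Z k.
  move=> n; have [_ /finset.set0Pn[p px]] := alP (n%:Z - 1).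
  have e : n%:Z - 1 + 1 = - n%:Z + n.*2%:Z by lia.
  rewrite e in px; have [Q QP] := back _ _ _ px.
  exists (fun k => Q (absz (k + n%:Z))) => k k1 k2.
  have [|QB Qa _ Ql] := QP (absz (k + n%:Z)); first lia.
  split=> //; first by rewrite Qa; congr al; lia.
  rewrite Ql ifT; last by lia.
  by congr (first_cols (Q _)); lia.
have [Q QP] := @exists_cluster [the finType of (r.-tuple bool * r.-tuple bool)%type] Z.
have Qgood k : good_at Q k.
  have [n kn ZQ] := QP (absz k).+2 (absz k).+3.
  have [||ZB Za Zl] := ZP n k; try lia.
  rewrite /good_at -!ZQ //=; lia.
have [y2 y2P] := @rows_of_sequence (fun k => (Q k).1)
  (fun k => let: And3 _ _ e := Qgood k in congr1 fst e).
have [y1 y1P] := @rows_of_sequence (fun k => (Q k).2)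
  (fun k => let: And3 _ _ e := Qgood k in congr1 snd e).
have ysP : solution_space N (y2, y1).
  by move=> k; rewrite /= y2P y1P -surjective_pairing; case: (Qgood k).
(* Pattern [Q (k - 1)] is the local row at k - 1, whose last column is k - 1 + [right_radius K];
   translating by s brings it to k. *)
pose s := (right_radius K)%:Z - 1.
rewrite layer_spaceE; exists (translate y2 s, translate y1 s).
  exact: (solution_translate s ysP).
apply/funext => k; rewrite /block_map.
have [xk1 /finset.set0Pn[p px]] := alP (k - 1); rewrite subrK in xk1 px.
have [_ ark] := Wx (k - 1); rewrite /= subrK in ark.
rewrite (cover_symbolE ark px); rewrite xk1 in px; rewrite (step_row px).
have r0 := rpred_gt0; rewrite -nth_last size_tuple nth_tail_tuple ?prednK //.
have [_ <- _] := Qgood (k - 1).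
have -> : layer_row l (Q (k - 1)) = local_row N (sol_layer (y2, y1)) (k - 1).
  by rewrite /sol_layer; case: l => /=; rewrite ?y1P ?y2P.
rewrite nth_local_row // /s.
have -> : sol_layer (translate y2 s, translate y1 s) = translate (sol_layer (y2, y1)) s.
  by rewrite /sol_layer; case: l.
by rewrite /translate; congr (sol_layer _ _); rewrite /s /rpred; lia.
Qed.

Lemma layer_space_image :
  layer_space N l = [set (block_map (cover_symbol N l) x : conf Ztime bool) | x in W N l].
Proof.
apply/seteqP; split=> [y|_ [x Wx <-]]; last exact: image_sub_layer_space.
rewrite layer_spaceE => -[ys ysP <-].
by have [x Wx <-] := layer_space_sub_image ysP; exists x.
Qed.

Lemma alphabetP (A : finType) (X : set (conf Ztime A)) x k :
  X x -> x k \in alphabet X.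
Proof. by move=> Xx; rewrite inE; apply/asboolP; exists x, k. Qed.

Hypothesis Wirr : irreducible (W N l).

(** All quantities of (ii) and (iii) are expressed through the single growth rate L that the cover
    and its layer space share. *)
Lemma cover_dimension (mu : probability (borel Ztime {set vertex N}) R) :
  Mmax R (W N l) mu -> exists L : R,
  [/\ entropy (W N l) mu = 2 * L,
      top_entropy R (Wplus N l) = L,
      dimH R (cover_alphabet N l) (W N l)
        = (2 * L / ln #|cover_alphabet N l|%:R)%:E,
      dimH R (alphabet (layer_space N l)) (layer_space N l)
        = (2 * L / ln #|alphabet (layer_space N l)|%:R)%:E &
      Mmax R (layer_space N l) (push (cover_symbol N l) mu) /\
      entropy (layer_space N l) (push (cover_symbol N l) mu) = 2 * L].
Proof.
move=> Wmu.
(* The measure gives mass 1 to the cover, which is therefore nonempty. *)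
have W0 : W N l !=set0.
  apply/set0P/negP => /eqP WE; have [[+ _] _] := Wmu.
  by rewrite WE measure0 => /eqP; rewrite eq_sym onee_eq0.
have Winv := @markov_translation_invariant _ (cover_alphabet N l) (arrow l).
have Wcl := @markov_limit_closed _ (cover_alphabet N l) (arrow l).
have [g Wg] := irreducible_gap_bounded Wirr.
have [L WL] := gap_bounded_growth R W0 Wg.
have Wrr := W_resolving.
have Ymu := push_Mmax W0 Winv Wcl WL Wrr Wmu.
have YE := layer_space_image.
exists L; split.
- by have [_ ->] := Wmu; exact: top_entropyZ.
- by apply: top_entropy_onesided WL; exact: cover_predecessor.
- by apply: (@dimH_growth R _ _ _ _ W0 Winv Wcl g) => // x k Wx; case: (Wx k).
- apply: (@dimH_growth R _ _ _ _ _ _ _ g); rewrite YE.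
  + by move=> x k; exact: alphabetP.
  + by have [x Wx] := W0; eexists; exists x.
  + exact: image_translation_invariant.
  + exact: image_limit_closed.
  + exact: image_gap_bounded.
  + exact: image_growth.
- rewrite YE; split; first exact: Ymu.
  have [_ ->] := Ymu; apply: top_entropyZ; first exact: image_translation_invariant.
  exact: image_growth.
Qed.

Lemma cover_one_to_one :
  has_sync_word (W N l) (layer_space N l) (cover_symbol N l) ->
  one_to_one_correspondence (Mmax R (W N l)) (Mmax R (layer_space N l)).
Proof.
rewrite layer_space_image => -[w [b [Yw wsync]]].
have W0 : W N l !=set0.
  by have [_ [_ [[x Wx _] _]]] := Yw; exists x.
have Winv := @markov_translation_invariant _ (cover_alphabet N l) (arrow l).
have Wcl := @markov_limit_closed _ (cover_alphabet N l) (arrow l).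
have [g Wg] := irreducible_gap_bounded Wirr.
have [L WL] := gap_bounded_growth R W0 Wg.
have /word_image[u wu uw] := Yw.
(* A preimage of the synchronizing word supplies the symbol a that the word forces. *)
case/lastP: u wu uw => [|u a] wu uw; first by case: w uw {Yw wsync}.
apply: (@Mmax_one_to_one R _ _ _ _ g L W0 Winv Wcl Wg WL W_resolving w b a Yw).
by move=> z t wz zw; apply: (wsync z t u a).
Qed.

End CoveringSpace.

Theorem theorem2p6 (R : realType) (N : cnn R)
    (hFSE : FSE (layer_space N layer1) (layer_space N layer2))
    (hirr1 : irreducible (W N layer1)) (hirr2 : irreducible (W N layer2))
    (i : layer)
    (hsync : has_sync_word (W N i) (layer_space N i) (cover_symbol N i)) :
  let Y := layer_space N in
  let m : R := #|cover_alphabet N i|%:R in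
  let n (l : layer) : R := #|alphabet (Y l)|%:R in
  let dimW := dimH R (cover_alphabet N i) (W N i) in
  let dimY (l : layer) := dimH R (alphabet (Y l)) (Y l) in
  [/\ (* (i) *)
      one_to_one_correspondence (Mmax R (W N i)) (Mmax R (Y i)),
      (* (ii) *)
      forall mu muplus, Mmax R (W N i) mu -> Mmax R (Wplus N i) muplus ->
        let nu := push (cover_symbol N i) mu in
        [/\ dimW = (entropy (W N i) mu / ln m)%:E,
            entropy (W N i) mu / ln m
              = 2 * (entropy (Wplus N i) muplus / ln m),
            dimY i = (entropy (Y i) nu / ln (n i))%:E,
            entropy (Y i) nu / ln (n i) = entropy (W N i) mu / ln (n i)
          & entropy (W N i) mu / ln (n i)
              = 2 * (entropy (Wplus N i) muplus / ln (n i))]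
    & (* (iii) *)
      forall pi, factor_map (W N i) (W N (other i)) pi ->
      forall mu mu', Mmax R (W N i) mu -> Mmax R (W N (other i)) mu' ->
      let nu := push (cover_symbol N i) mu in
      let nu' := push (cover_symbol N (other i)) mu' in
      dimY i = (entropy (Y i) nu / ln (n i))%:E ->
      exists2 pibar, measure_map (Mmax R (Y i)) (Mmax R (Y (other i))) pibar &
        dimY (other i)
          = (entropy (Y (other i)) (pibar nu) / ln (n (other i)))%:E /\
        entropy (Y (other i)) (pibar nu) / ln (n (other i))
          = entropy (Y (other i)) nu' / ln (n (other i))].
Proof.
have irr l : irreducible (W N l) by case: l.
split; first exact: cover_one_to_one.
  move=> mu muplus Wmu [_ hplus].
  have [L [hW hWp dW dY [_ hY]]] := cover_dimension (irr i) Wmu.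
  rewrite /= hplus hWp hW hY dW dY; split=> //; exact: esym (mulrA _ _ _).
move=> pi _ mu mu' Wmu Wmu' nu nu' _.
have [L [_ _ _ dY [Ymu' hY]]] := cover_dimension (irr (other i)) Wmu'.
(* The witness is the constant map with value [nu'], which [cover_dimension] shows to be maximal and
   to realize the dimension. *)
exists (fun=> nu'); first by split=> // nu1 Ynu1; exact: Ymu'.
by rewrite dY /nu' hY.
Qed.
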